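(* For each $n$ let $\ell=\ell(n)\ge 1$ be an integer with $\ell(n)=o(\log n)$, let $m=m(n)$ be a positive integer with $m(n)=\Omega(n^3\log n)$, and let $q=\ell\cdot\frac{m}{n}$. Let $w_1\le\dots\le w_n$ be the weights generated by the uniform balls and bins process with $m$ balls and $n$ bins, and let $\varphi_1$ be the Shapley value of agent $1$ (the agent of minimal weight) in the weighted voting game with these weights and quota $q$. Then, as $n\to\infty$, $$\mathbb{E}[\varphi_1]=\frac{1}{2n}+o\left(\frac1n\right),$$ where the expectation is over the generation of the weights.
   Context: Uniform balls and bins process: each of $m$ balls is thrown independently into one of $n$ bins, each bin having probability $1/n$; the weights $w_1\le\dots\le w_n$ are the resulting bin loads sorted in non-decreasing order. Weighted voting game with agents $N=\{1,\dots,n\}$, weights $w_i$ and quota $q$: for $S\subseteq N$ let $w(S)=\sum_{i\in S}w_i$; $v(S)=1$ if $w(S)\ge q$, and $v(S)=0$ otherwise. Shapley value: $\varphi_i=\frac1{n!}\sum_{\sigma}\left(v(P_i(\sigma)\cup\{i\})-v(P_i(\sigma))\right)$, the sum over all permutations $\sigma$ of $N$, where $P_i(\sigma)=\{j\in N:\sigma(j)<\sigma(i)\}$. *)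

(* Defs.v *)
From HB Require Import structures.
From mathcomp Require Import all_boot all_order all_algebra perm.
From mathcomp Require Import all_classical all_reals all_analysis.

Set Implicit Arguments.
Unset Strict Implicit.
Unset Printing Implicit Defensive.

Import Order.TTheory GRing.Theory Num.Theory.
Import numFieldNormedType.Exports.
Local Open Scope ring_scope.

Section CooperativeGames.
Variables (R : realType) (n : nat).

Definition weighted_voting_game (w : 'I_n -> R) (q : R) (S : {set 'I_n}) : R :=
  if q <= \sum_(i in S) w i then 1 else 0.

Definition predecessors (s : {perm 'I_n}) (i : 'I_n) : {set 'I_n} :=
  [set j : 'I_n | (s j < s i)%N]%SET.

Definition shapley (v : {set 'I_n} -> R) (i : 'I_n) : R :=
  (n`!%:R)^-1 * \sum_(s : {perm 'I_n})
     (v (i |: predecessors s i) - v (predecessors s i)).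

End CooperativeGames.

Section BallsAndBins.
Variables (R : realType) (n m : nat).

(* An outcome assigns to each of the m balls the bin it falls into. *)
Definition throws := {ffun 'I_m -> 'I_n}.

Definition bin_prob (b : 'I_n) : R := n%:R^-1.

(* Product law: the balls are thrown independently. *)
Definition throws_prob (f : throws) : R := \prod_(x < m) bin_prob (f x).

Definition throws_expectation (X : throws -> R) : R :=
  \sum_(f : throws) throws_prob f * X f.

Definition load (f : throws) (b : 'I_n) : nat := #|[set x : 'I_m | f x == b]%SET|.

(* Agent [i : 'I_n] (0-based) gets the i-th smallest load. *)
Definition sorted_load (f : throws) (i : 'I_n) : nat :=
  nth 0%N (sort leq [seq load f b | b <- enum 'I_n]) i.

End BallsAndBins.

(* Expected Shapley value of the agent of minimal weight ([ord0]), for m balls,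
   n'.+1 bins and quota q. *)
Definition expected_shapley_min (R : realType) (n' m : nat) (q : R) : R :=
  throws_expectation (fun f : throws n'.+1 m =>
    shapley (weighted_voting_game (fun i => (sorted_load f i)%:R) q) ord0).

(* Main.v *)
(* Let [n = n'.+1], [lam = m / n], [q = l * lam], and let [i] be the lightest agent.
   Grouping permutations by the position [r] of [i] gives
   [n * phi_i = sum_r (A (r + 1) r - A r r)], where [A k r] is the probability that
   the first [k] agents win given that [i] sits at position [r]. Moving the lightest
   agent into a prefix can only lower its weight, so [A (r + 1) r] and [A r r] are
   bounded by the unconditional winning probabilities [c_(r + 1)] and [c_r] from above
   and below; the sum telescopes to [0 <= n * phi_i <= 1], hence events of small
   probability may be ignored. By Chebyshev all loads are within [lam / (l + 2)] of
   [lam] with high probability, and then only [r = l - 1] and [r = l] contribute.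
   The term [r = l] is [1 - A l l], which is [1 - c_l] up to [l / n]; over the loads
   this averages to [P(Bin(m, l / n) < m l / n)], which tends to [1 / 2]. The term
   [r = l - 1] is negligible: the minimal load is below
   [lam - sqrt (K l lam)] with high probability (second moment method, negative
   correlation of loads, and a Gaussian-type lower bound for the binomial tail;
   [l = o(log n)] enters here), whereas by Chebyshev the other [l - 1] agents exceed
   their mean by that much with probability at most [1 / K]. *)
Require Import Defs.
From HB Require Import structures.
From mathcomp Require Import all_boot all_order all_algebra perm.
From mathcomp Require Import all_classical all_reals all_analysis.
From mathcomp Require Import zify ring lra.

Set Implicit Arguments.
Unset Strict Implicit.
Unset Printing Implicit Defensive.

Import Order.TTheory GRing.Theory Num.Theory.
Import numFieldNormedType.Exports.
Local Open Scope classical_set_scope.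
Local Open Scope ring_scope.

(** * Binomial distribution *)

Definition binomial_mean (R : realType) (m : nat) (p : R) (g : nat -> R) : R :=
  \sum_(k < m.+1) binomial_pmf m p k * g k.

Section BinomialLaw.
Variables (R : realType) (p : R).
Implicit Types (g h : nat -> R) (m k : nat).

Lemma binomial_pmfE m k :
  binomial_pmf m p k = 'C(m, k)%:R * (p ^+ k * (1 - p) ^+ (m - k)).
Proof. by rewrite /binomial_pmf -mulr_natl. Qed.

Lemma binomial_pmf_out m k : (m < k)%N -> binomial_pmf m p k = 0.
Proof. by move=> mk; rewrite binomial_pmfE bin_small// mul0r. Qed.

Lemma binomial_pmfS0 m : binomial_pmf m.+1 p 0 = (1 - p) * binomial_pmf m p 0.
Proof. by rewrite !binomial_pmfE !bin0 !subn0 exprS; ring. Qed.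

Lemma binomial_pmfSS m k : binomial_pmf m.+1 p k.+1 =
  p * binomial_pmf m p k + (1 - p) * binomial_pmf m p k.+1.
Proof.
rewrite !binomial_pmfE binS natrD subSS.
have [km|mk] := ltnP k m.
  by rewrite (_ : (m - k = (m - k.+1).+1)%N); [rewrite !exprS; ring | lia].
by rewrite (@bin_small m k.+1) // !exprS; ring.
Qed.

Lemma binomial_mean_widen m g n : (m <= n)%N ->
  binomial_mean m p g = \sum_(k < n.+1) binomial_pmf m p k * g k.
Proof.
move=> mn; rewrite /binomial_mean.
rewrite (big_ord_widen n.+1 (fun k => binomial_pmf m p k * g k)) //.
rewrite big_mkcond; apply: eq_bigr => k _; case: ifPn => //.
by rewrite -leqNgt => mk; rewrite binomial_pmf_out ?mul0r.
Qed.

Lemma binomial_mean0 g : binomial_mean 0 p g = g 0%N.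
Proof.
by rewrite /binomial_mean big_ord_recl big_ord0 binomial_pmfE /= bin0 expr0 !mul1r addr0.
Qed.

(** Conditioning on one trial. This recursion drives the moment computation and identifies the law
    of the loads. *)
Lemma binomial_meanS m g : binomial_mean m.+1 p g =
  p * binomial_mean m p (fun k => g k.+1) + (1 - p) * binomial_mean m p g.
Proof.
rewrite (@binomial_mean_widen m g m.+1) // /binomial_mean.
rewrite !(big_ord_recl m.+1) /= binomial_pmfS0.
under eq_bigr do rewrite /bump /= add1n binomial_pmfSS mulrDl.
rewrite big_split /= mulrDr !mulr_sumr addrCA mulrA.
by congr (_ + (_ + _)); apply: eq_bigr => k _; rewrite mulrA.
Qed.

Lemma eq_binomial_mean m g h : g =1 h -> binomial_mean m p g = binomial_mean m p h.
Proof. by move=> gh; apply: eq_bigr => k _; rewrite gh. Qed.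

Lemma binomial_mean1 m : binomial_mean m p (fun=> 1) = 1.
Proof. by elim: m => [|m IH]; rewrite ?binomial_mean0// binomial_meanS IH; ring. Qed.

Lemma binomial_meanD m g h :
  binomial_mean m p (fun k => g k + h k) = binomial_mean m p g + binomial_mean m p h.
Proof. by rewrite -big_split; apply: eq_bigr => k _; rewrite mulrDr. Qed.

Lemma binomial_meanZ m c g :
  binomial_mean m p (fun k => c * g k) = c * binomial_mean m p g.
Proof. by rewrite /binomial_mean mulr_sumr; apply: eq_bigr => k _; rewrite mulrCA. Qed.

(** The centre [c] stays free for the sake of the induction: a success turns it into [c - 1]. At
    [c = m * p] the value is the variance. *)
Lemma binomial_mean_square m c :
  binomial_mean m p (fun k => (k%:R - c) ^+ 2) =
  m%:R * p * (1 - p) + (m%:R * p - c) ^+ 2.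
Proof.
elim: m c => [|m IH] c; first by rewrite binomial_mean0; ring.
rewrite binomial_meanS IH (@eq_binomial_mean _ _ (fun k => (k%:R - (c - 1)) ^+ 2)).
  by rewrite IH -natr1; ring.
by move=> k; rewrite -natr1; ring.
Qed.

Hypothesis p01 : 0 <= p <= 1.

Lemma le_binomial_mean m g h : (forall k, (k <= m)%N -> g k <= h k) ->
  binomial_mean m p g <= binomial_mean m p h.
Proof.
move=> gh; apply: ler_sum => k _; apply: ler_wpM2l; first exact: binomial_pmf_ge0.
by apply: gh; rewrite -ltnS.
Qed.

(** Stated for any event inside the deviation event, so that one-sided, two-sided and strict tails
    are all instances. *)
Lemma binomial_chebyshev m (t : R) (P : pred nat) : 0 < t ->
  (forall k, P k -> t <= `|k%:R - m%:R * p|) ->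
  binomial_mean m p (fun k => (P k)%:R) <= m%:R * p * (1 - p) / t ^+ 2.
Proof.
move=> t0 Pt; rewrite ler_pdivlMr ?exprn_gt0// mulrC -binomial_meanZ.
have -> : m%:R * p * (1 - p) = binomial_mean m p (fun k => (k%:R - m%:R * p) ^+ 2).
  by rewrite binomial_mean_square subrr expr0n addr0.
apply: le_binomial_mean => k _; case: (boolP (P k)) => [/Pt tk|_]; last first.
  by rewrite mulr0 sqr_ge0.
rewrite mulr1 -(real_normK (num_real (k%:R - _))).
by apply: lerXn2r; rewrite ?nnegrE ?normr_ge0 ?(ltW t0).
Qed.

Lemma binomial_meanC m (P : pred nat) :
  binomial_mean m p (fun k => (~~ P k)%:R) = 1 - binomial_mean m p (fun k => (P k)%:R).
Proof.
apply/eqP; rewrite eq_sym subr_eq -binomial_meanD -[eqbLHS](binomial_mean1 m); apply/eqP.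
by apply: eq_binomial_mean => k; case: (P k) => /=; ring.
Qed.

End BinomialLaw.

(** * Ratios of binomial masses and a Gaussian-type lower tail *)

Section BinomialTails.
Variables (R : realType) (m : nat) (p : R).
Hypothesis p01 : 0 < p < 1.

Let mu : R := m%:R * p.
Let V : R := m%:R * p * (1 - p).
Let b k : R := binomial_pmf m p k.

Let p0 : 0 < p. Proof. by case/andP: p01. Qed.
Let p1 : 0 < 1 - p. Proof. by rewrite subr_gt0; case/andP: p01. Qed.
Let p01W : 0 <= p <= 1. Proof. by case/andP: p01 => /ltW -> /ltW ->. Qed.
Let b_ge0 k : 0 <= b k. Proof. exact: binomial_pmf_ge0. Qed.

(** Ratio of consecutive masses, without denominators so that it also covers [k >= m], where both
    sides vanish. *)
Lemma binomial_pmf_step k :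
  k.+1%:R * (1 - p) * b k.+1 = (m%:R - k%:R) * p * b k.
Proof.
have [km|] := ltnP k m; last first.
  rewrite leq_eqVlt => /predU1P[<-|mk]; rewrite /b.
    by rewrite binomial_pmf_out// subrr mul0r mul0r mulr0.
  by rewrite !binomial_pmf_out ?mulr0// ltnW.
rewrite /b !binomial_pmfE -natrB ?(ltnW km)//.
have := mul_bin_left m k; move=> /(congr1 (fun x => x%:R : R)); rewrite !natrM => E.
rewrite (_ : (m - k = (m - k.+1).+1)%N) in E *; last by lia.
rewrite !exprS; set x := p ^+ k; set y := (1 - p) ^+ _.
transitivity ((k.+1%:R * 'C(m, k.+1)%:R) * ((1 - p) * p * x * y)); first by ring.
by rewrite E; ring.
Qed.

(** The ratio [b k / b k.+1] increases with [k]. Its value at [k = mu - i] is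
    [(V - i (1 - p) + (1 - p)) / (V + i p)], which is at least [1 - (i + 1) / V]. *)
Lemma binomial_pmf_shift1 (i : R) k : 0 <= i -> mu - i <= k%:R -> i + 1 <= V ->
  (1 - (i + 1) / V) * b k.+1 <= b k.
Proof.
move=> i0 ki iV; have V0 : 0 < V by lra.
have [km|mk] := ltnP k m; last first.
  by rewrite /b [binomial_pmf m p k.+1]binomial_pmf_out// mulr0 b_ge0.
have c0 : 0 < (m%:R - k%:R) * p.
  by rewrite mulr_gt0 // subr_gt0 ltr_nat.
rewrite -(ler_pM2l c0) -binomial_pmf_step // mulrA ler_wpM2r //.
have xV : (1 - (i + 1) / V) * V = V - (i + 1).
  by rewrite mulrBl mul1r divfK // lt0r_neq0.
rewrite -(ler_pM2r V0) -[leLHS]mulrA xV.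
rewrite -natr1.
have mk0 : 0 <= m%:R - k%:R :> R by rewrite subr_ge0 ler_nat ltnW.
have k0 : 0 <= k%:R :> R by [].
have kp : (k%:R - (mu - i)) >= 0 by rewrite subr_ge0.
have pp : 0 <= p <= 1 by exact: p01W.
set kk := k%:R in c0 mk0 k0 kp ki *; set mm := m%:R in c0 mk0 *.
have Vm : V = mm * p * (1 - p) by [].
have mum : mu = mm * p by [].
have iV' : 0 <= V - (i + 1) by rewrite subr_ge0.
have h1 : (mm - kk) * p <= V + i * p.
  by have := ltW p0; rewrite Vm; move: kp; rewrite mum; nra.
have h2 : V - i * (1 - p) <= kk * (1 - p).
  by have := ltW p1; rewrite Vm; move: kp; rewrite mum; nra.
apply: (@le_trans _ _ ((V + i * p) * (V - (i + 1)))); first exact: ler_wpM2r.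
apply: (@le_trans _ _ ((V - i * (1 - p) + (1 - p)) * V)); last first.
  by rewrite ler_pM2r// mulrDl mul1r lerD2r.
have := ltW p0; have := ltW p1; nra.
Qed.

Lemma binomial_pmf_shift (i : R) (s k : nat) : 0 <= i -> mu - i <= k%:R -> i + 1 <= V ->
  (1 - (i + 1) / V) ^+ s * b (k + s) <= b k.
Proof.
move=> i0 ki iV; have V0 : 0 < V by lra.
elim: s => [|s IH]; first by rewrite expr0 mul1r addn0.
apply: le_trans IH; rewrite exprSr -mulrA ler_wpM2l //.
  by rewrite exprn_ge0// subr_ge0 ler_pdivrMr// mul1r.
rewrite addnS; apply: binomial_pmf_shift1 => //.
by rewrite natrD (le_trans ki)// lerDl.
Qed.

(* Shifting the bulk [|X - mu| < 2 sd] down by [s] costs a factor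
   [(1 - x)^s] at most. *)
Lemma binomial_lower_tail (sd a : R) (s : nat) :
  0 < sd -> sd ^+ 2 = V -> 2 * sd + s%:R + 1 <= V -> mu + 2 * sd - s%:R <= a ->
  3 / 4 * (1 - (2 * sd + s%:R + 1) / V) ^+ s <=
  binomial_mean m p (fun k => (k%:R <= a)%R%:R).
Proof.
move=> sd0 sdV sV sa; set i := 2 * sd + s%:R; set x := 1 - _.
have V0 : 0 < V by rewrite -sdV exprn_gt0.
have i0 : 0 <= i by rewrite addr_ge0// mulr_ge0// ltW.
have x0 : 0 <= x by rewrite subr_ge0 ler_pdivrMr// mul1r.
(* Chebyshev at two standard deviations leaves mass [1 - 1 / 4]. *)
have bulk : 3 / 4 <= binomial_mean m p (fun k => (~~ (2 * sd <= `|k%:R - mu|))%R%:R).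
  rewrite binomial_meanC.
  have := @binomial_chebyshev R p p01W m (2 * sd) (fun k => 2 * sd <= `|k%:R - mu|).
  rewrite -/V exprMn sdV mulr_gt0 // => /(_ isT (fun _ => id)).
  have -> : V / (2 ^+ 2 * V) = 1 / 4.
    by field; rewrite gt_eqF.
  lra.
apply: (@le_trans _ _ (x ^+ s * binomial_mean m p (fun k => (~~ (2 * sd <= `|k%:R - mu|))%R%:R))).
  by rewrite mulrC ler_wpM2l// exprn_ge0.
rewrite /binomial_mean mulr_sumr.
rewrite -(big_mkord xpredT (fun k => x ^+ s * (b k * (~~ (2 * sd <= `|k%:R - mu|))%R%:R))).
rewrite -(big_mkord xpredT (fun k => b k * (k%:R <= a)%R%:R)).
(* With [V <= mu], the bulk lies above [V - 2 * sd > s]: indices below [s] contribute nothing, and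
   shifting down by [s] stays within the naturals. *)
have muV : V <= mu by rewrite /V ler_piMr ?mulr_ge0 ?(ltW p0)// lerBlDr lerDl ltW.
have [sm|ms] := ltnP m s; last first.
  rewrite (@big_cat_nat _ _ _ s) ?(leqW ms)//=.
  rewrite [X in X + _]big_nat_cond [X in X + _]big1 ?add0r; last first.
    move=> k /andP[/andP[_ ks] _]; case: leP => [_|] /=; first by rewrite !mulr0.
    rewrite ltr_norml => /andP[/ltW]; rewrite -(ltr_nat R) in ks.
    by move=> h _; exfalso; lra.
  rewrite -{1}[s in \sum_(s <= _ < _) _]add0n big_addn.
  rewrite [leRHS](@big_cat_nat _ _ _ (m.+1 - s)) ?leq_subr//=.
  apply: ler_wpDr; first by apply: sumr_ge0 => k _; rewrite mulr_ge0.
  apply: ler_sum => k _; case: (leP (2 * sd) `|(k + s)%:R - mu|) => [_|] /=; first by rewrite !mulr0 mulr_ge0.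
  rewrite ltr_norml natrD => /andP[h1 h2].
  have -> : k%:R <= a by lra.
  rewrite !mulr1; apply: binomial_pmf_shift => //; rewrite /i; lra.
rewrite big1_seq ?sumr_ge0// => k; first by move=> _; rewrite mulr_ge0.
rewrite mem_index_iota => /andP[_ /andP[_ km]]; case: leP => [_|] /=; first by rewrite !mulr0.
rewrite ltr_norml => /andP[/ltW h _]; exfalso.
have : k%:R < s%:R :> R by rewrite ltr_nat (leq_trans km).
lra.
Qed.

End BinomialTails.

Lemma bernoulli_inequality (R : realType) (x : R) (n : nat) : 0 <= x <= 1 ->
  1 - n%:R * x <= (1 - x) ^+ n.
Proof.
move=> /andP[x0 x1]; elim: n => [|n IH]; first by rewrite mul0r subr0 expr0.
apply: (@le_trans _ _ ((1 - x) * (1 - n%:R * x))); last first.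
  by rewrite exprS ler_wpM2l// subr_ge0.
have : 0 <= n%:R * (x * x) by rewrite !mulr_ge0.
rewrite -natr1; lra.
Qed.

Lemma binomial_mean_interval (R : realType) (m : nat) (p : R) (i n : nat) :
  binomial_mean m p (fun k => (i <= k < n)%N%:R) = \sum_(i <= k < n) binomial_pmf m p k.
Proof.
rewrite (@binomial_mean_widen _ _ _ _ (maxn m n)) ?leq_maxl//.
rewrite (@big_nat_widen _ _ _ i n (maxn m n).+1) ?leqW ?leq_maxr//.
rewrite (@big_nat_widenl _ _ _ i 0%N)//.
rewrite big_mkord big_mkcond [RHS]big_mkcond; apply: eq_bigr => k _ /=.
by rewrite andbC; case: ifP => _; rewrite ?mulr1 ?mulr0.
Qed.

(** Reads the lower half of a window from its centre outwards, to pair it with the upper half. *)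
Lemma big_nat_reflect (V : nmodType) (F : nat -> V) (c J : nat) : (J <= c.+1)%N ->
  \sum_(c.+1 - J <= k < c.+1) F k = \sum_(j < J) F (c - j)%N.
Proof.
move=> Jc; rewrite big_nat_rev -{1}[(c.+1 - J)%N]add0n big_addn /=.
rewrite subKn// big_mkord; apply: eq_bigr => j _; congr F.
have := ltn_ord j; lia.
Qed.

(** * The mean of a binomial law is almost a median *)

Section BinomialMedian.
Variables (R : realType) (m : nat) (p : R).
Hypothesis p01 : 0 < p < 1.

Let mu : R := m%:R * p.
Let V : R := m%:R * p * (1 - p).
Let b k : R := binomial_pmf m p k.

Variables (c J : nat) (delta : R).
Hypotheses (c_mu : c%:R < mu <= c.+1%:R) (J_gt0 : (0 < J)%N) (J_V : J%:R < V).

(** Lower bound for [(Y ^+ 2 - t ^+ 2) / (X ^+ 2 - s ^+ 2)] when [X] and [Y] lie in [[V, V + 1]] and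
    [s], [t] in [[0, J]]. It controls how much one step outwards can change the ratio of two
    mirrored masses. *)
Let rho : R := (V ^+ 2 - J%:R ^+ 2) / (V + 1) ^+ 2.

Let p0 : 0 < p. Proof. by case/andP: p01. Qed.
Let p1 : 0 < 1 - p. Proof. by rewrite subr_gt0; case/andP: p01. Qed.
Let p01W : 0 <= p <= 1. Proof. by case/andP: p01 => /ltW -> /ltW ->. Qed.
Let b_ge0 k : 0 <= b k. Proof. exact: binomial_pmf_ge0. Qed.
Let J0 : 0 < J%:R :> R. Proof. by rewrite ltr0n. Qed.
Let V0 : 0 < V. Proof. exact: lt_trans J_V. Qed.
Let V1 : 0 < (V + 1) ^+ 2. Proof. by rewrite exprn_gt0// addr_gt0. Qed.

Let rho_ge0 : 0 <= rho.
Proof.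
rewrite divr_ge0 ?(ltW V1)// subr_ge0 lerXn2r ?nnegrE ?(ltW J0) ?(ltW V0)//.
exact: ltW.
Qed.

Let rhoE : 1 - rho = (2 * V + 1 + J%:R ^+ 2) / (V + 1) ^+ 2.
Proof. by rewrite /rho; field; rewrite gt_eqF// addr_gt0. Qed.

Let rho_le1 : rho <= 1.
Proof.
rewrite -subr_ge0 rhoE divr_ge0 ?(ltW V1)//.
by rewrite !addr_ge0 ?sqr_ge0// mulr_ge0// ltW.
Qed.

Let JleC : (J <= c.+1)%N.
Proof.
rewrite -(ler_nat R) (le_trans (ltW J_V))//.
case/andP: c_mu => _; apply: le_trans.
by rewrite /V ler_piMr ?mulr_ge0 ?(ltW p0)// lerBlDr lerDl ltW.
Qed.

(** [A] and [B] are the coefficients of [binomial_pmf_step] at [k = c], so [B * b c.+1 = A * b c].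
    Both are within [1] of [V] because [mu] lies between [c] and [c + 1]. *)
Let A : R := (m%:R - c%:R) * p.
Let B : R := c.+1%:R * (1 - p).

Let AV : V <= A <= V + 1.
Proof.
case/andP: c_mu; rewrite /A /V /mu -natr1; set cc : R := c%:R; set mm : R := m%:R.
move=> h1 h2; have := p0; have := p1 => ? ?; apply/andP; split; nra.
Qed.

Let BV : V <= B <= V + 1.
Proof.
case/andP: c_mu; rewrite /B /V /mu -natr1; set cc : R := c%:R; set mm : R := m%:R.
move=> h1 h2; have := p0; have := p1 => ? ?; apply/andP; split; nra.
Qed.

Let product_ratio (X Y s t : R) : V <= X <= V + 1 -> V <= Y <= V + 1 ->
  0 <= s <= J%:R -> 0 <= t <= J%:R ->
  rho * ((X - s) * (X + s)) <= (Y - t) * (Y + t).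
Proof.
move=> /andP[X1 X2] /andP[Y1 Y2] /andP[s0 s1] /andP[t0 t1].
apply: (@le_trans _ _ (rho * (V + 1) ^+ 2)).
  rewrite ler_wpM2l// -subr_sqr; have := sqr_ge0 s.
  have : X ^+ 2 <= (V + 1) ^+ 2.
    by have := V0 => ?; apply: lerXn2r; rewrite ?nnegrE; lra.
  lra.
have := V0; have := J0 => ? ?; rewrite /rho divfK ?gt_eqF// -subr_sqr lerB//.
  by apply: lerXn2r; rewrite ?nnegrE; lra.
by apply: lerXn2r; rewrite ?nnegrE; lra.
Qed.

(** Going outwards by one, with [d = j + 1], multiplies the upper mass by
    [(A - d p) / (B + d (1 - p))] and the lower one by [(B - d (1 - p)) / (A + d p)]. The quotient
    of these factors is a ratio of differences of squares, which [product_ratio] keeps between [rho]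
    and its inverse. *)
Let reflect_ratio j : (j < J)%N ->
  rho ^+ j.+1 * b (c - j) <= b (c + j.+1) /\ rho ^+ j.+1 * b (c + j.+1) <= b (c - j).
Proof.
have A0 : 0 < A by case/andP: AV => h _; exact: lt_le_trans h.
have B0 : 0 < B by case/andP: BV => h _; exact: lt_le_trans h.
have Jp : J%:R * p <= J%:R by rewrite ler_piMr ?(ltW J0)//; case/andP: p01W.
have Jq : J%:R * (1 - p) <= J%:R by rewrite ler_piMr ?(ltW J0)// lerBlDr lerDl ltW.
elim: j => [|j IH] jJ.
  have := binomial_pmf_step m p01 c; rewrite -/B -/A -/(b _) -/(b _) addn1 subn0 expr1 => E.
  have rhoV : rho * (V + 1) <= V.
    rewrite -(ler_pM2r (addr_gt0 V0 ltr01)) -mulrA -expr2 /rho divfK ?gt_eqF//.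
    by have := sqr_ge0 (J%:R : R); have := V0; nra.
  have rhoX X Y : V <= X <= V + 1 -> V <= Y <= V + 1 -> rho * X <= Y.
    move=> /andP[_ X1] /andP[Y1 _]; apply: le_trans Y1; apply: le_trans rhoV.
    by rewrite ler_wpM2l.
  split.
    by rewrite -(ler_pM2r B0) [leRHS]mulrC E mulrAC ler_wpM2r // rhoX.
  by rewrite -(ler_pM2l A0) -E mulrA [A * _]mulrC ler_wpM2r // rhoX.
have {IH} [IH1 IH2] := IH (ltnW jJ).
have jc : (j.+1 <= c)%N by rewrite -ltnS (leq_trans jJ).
have E1 := binomial_pmf_step m p01 (c + j.+1).
have E2 := binomial_pmf_step m p01 (c - j.+1).
have e2 := subnSK jc.
rewrite e2 -/(b _) -/(b _) in E2; rewrite -addnS -/(b _) -/(b _) in E1.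
set y := b (c + j.+1) in IH1 IH2 E1; set x := b (c - j) in IH1 IH2 E2.
set y' := b (c + j.+2) in E1 *; set x' := b (c - j.+1) in E2 *.
have x0 : 0 <= x by exact: b_ge0.
have y0 : 0 <= y by exact: b_ge0.
set d : R := j.+1%:R.
have dJ : d <= J%:R by rewrite ler_nat ltnW.
have d0 : 0 <= d by [].
have {}E1 : (B + d * (1 - p)) * y' = (A - d * p) * y.
  move: E1; rewrite addnS -natr1 natrD -/d => E1.
  rewrite (_ : A - _ = (m%:R - (c%:R + d)) * p); last by rewrite /A; ring.
  by rewrite -E1 /B -natr1; ring.
have {}E2 : (B - d * (1 - p)) * x = (A + d * p) * x'.
  move: E2; rewrite -e2 -natr1 natrB// -/d /A => E2.
  rewrite (_ : B - _ = (c%:R - d + 1) * (1 - p)); last by rewrite /B -natr1; ring.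
  by rewrite E2; ring.
have dp : 0 <= d * p <= J%:R.
  by rewrite mulr_ge0 ?(ltW p0)//= (le_trans _ Jp)// ler_wpM2r ?(ltW p0).
have dq : 0 <= d * (1 - p) <= J%:R.
  by rewrite mulr_ge0 ?(ltW p1)//= (le_trans _ Jq)// ler_wpM2r ?(ltW p1).
have k1 := product_ratio AV BV dp dq; have k2 := product_ratio BV AV dq dp.
have Bp : 0 < B + d * (1 - p) by rewrite ltr_wpDr//; case/andP: dq.
have Ap : 0 < A + d * p by rewrite ltr_wpDr//; case/andP: dp.
split; rewrite -(ler_pM2r (mulr_gt0 Ap Bp)) exprS.
  apply: (@le_trans _ _ (rho * ((B - d * (1 - p)) * (B + d * (1 - p))) * y)).
    rewrite [leLHS](_ : _ = rho * (B + d * (1 - p)) * (rho ^+ j.+1) * ((A + d * p) * x')); last by ring.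
    rewrite -E2.
    rewrite [leLHS](_ : _ = rho * ((B - d * (1 - p)) * (B + d * (1 - p))) * (rho ^+ j.+1 * x)); last by ring.
    rewrite ler_wpM2l// mulr_ge0// mulr_ge0 ?(ltW Bp)// subr_ge0.
    case/andP: dq => _ h; case/andP: BV => h' _.
    by rewrite (le_trans h)// (le_trans (ltW J_V)).
  rewrite [leRHS](_ : _ = (A + d * p) * ((B + d * (1 - p)) * y')); last by ring.
  rewrite E1 [leRHS](_ : _ = (A - d * p) * (A + d * p) * y); last by ring.
  by rewrite ler_wpM2r.
apply: (@le_trans _ _ (rho * ((A - d * p) * (A + d * p)) * x)).
  rewrite [leLHS](_ : _ = rho * (A + d * p) * (rho ^+ j.+1) * ((B + d * (1 - p)) * y')); last by ring.
  rewrite E1.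
  rewrite [leLHS](_ : _ = rho * ((A - d * p) * (A + d * p)) * (rho ^+ j.+1 * y)); last by ring.
  rewrite ler_wpM2l// mulr_ge0// mulr_ge0 ?(ltW Ap)// subr_ge0.
  case/andP: dp => _ h; case/andP: AV => h' _.
  by rewrite (le_trans h)// (le_trans (ltW J_V)).
rewrite [leRHS](_ : _ = (B + d * (1 - p)) * ((A + d * p) * x')); last by ring.
rewrite -E2 [leRHS](_ : _ = (B - d * (1 - p)) * (B + d * (1 - p)) * x); last by ring.
by rewrite ler_wpM2r.
Qed.

(* The window [(c - J, c + J]] carries mass [1 - V / J ^+ 2], and the reflection
   [c - j <-> c + 1 + j] shows that its two halves have almost equal mass. *)
Lemma binomial_median : V / J%:R ^+ 2 <= delta ->
  J%:R * (2 * V + 1 + J%:R ^+ 2) / (V + 1) ^+ 2 <= delta ->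
  `|binomial_mean m p (fun k => (k%:R < mu)%R%:R) - 1 / 2| <= delta.
Proof.
move=> d1 d2; have [cmu muc] := andP c_mu.
pose D := \sum_(c.+1 - J <= k < c.+1) b k; pose U := \sum_(c.+1 <= k < c.+1 + J) b k.
(* Bernoulli's inequality reduces this to [J * (1 - rho) <= delta], which is the second assumption
   on [delta]. *)
have rJ : 1 - delta <= rho ^+ J.
  apply: (@le_trans _ _ (1 - J%:R * (1 - rho))); first by rewrite lerB// rhoE mulrA.
  rewrite -{2}[rho](subKr 1); apply: bernoulli_inequality.
  by rewrite subr_ge0 rho_le1 lerBlDr lerDl.
have r0 : 0 <= rho ^+ J by rewrite exprn_ge0.
have rle j : (j < J)%N -> rho ^+ J <= rho ^+ j.+1.
  by move=> jJ; apply: ler_wiXn2l => //; rewrite rho_ge0.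
have UE : U = \sum_(j < J) b (c + j.+1).
  rewrite /U -{1}[c.+1]add0n big_addn addnC addnK big_mkord.
  by apply: eq_bigr => j _; rewrite addnS addnC -addSn addnS addSn.
have DU : rho ^+ J * D <= U.
  rewrite /D big_nat_reflect// UE mulr_sumr; apply: ler_sum => j _.
  have [h _] := reflect_ratio (ltn_ord j); apply: le_trans h.
  by rewrite ler_wpM2r// rle.
have UD : rho ^+ J * U <= D.
  rewrite /D big_nat_reflect// UE mulr_sumr; apply: ler_sum => j _.
  have [_ h] := reflect_ratio (ltn_ord j); apply: le_trans h.
  by rewrite ler_wpM2r// rle.
have D0 : 0 <= D by exact: sumr_ge0.
have U0 : 0 <= U by exact: sumr_ge0.
set q := binomial_mean _ _ _.
(* Since [c < mu <= c + 1], the event [k < mu] is exactly [k <= c]: it contains the lower half of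
   the window and misses the upper half. *)
have qD : D <= q.
  rewrite /D -binomial_mean_interval; apply: le_binomial_mean => // k _.
  case: andP => [[_ kc]|_] //=.
  by rewrite (le_lt_trans _ cmu)// ler_nat -ltnS.
have qU : q + U <= 1.
  rewrite /U -binomial_mean_interval -binomial_meanD -[leRHS](binomial_mean1 p m).
  apply: le_binomial_mean => // k _; case: (ltP k%:R mu) => [kmu|_] /=; last first.
    by rewrite add0r lern1 leq_b1.
  rewrite leqNgt -(ltr_nat R) (lt_le_trans kmu)//= ?addr0//.
(* An index outside the window is at distance at least [J] from [mu]. *)
have mass : 1 - V / J%:R ^+ 2 <= D + U.
  rewrite lerBlDr.
  have := @binomial_chebyshev R p p01W m J%:R (fun k => J%:R <= `|k%:R - mu|) J0 (fun _ => id).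
  rewrite -/V => h; apply: le_trans (lerD (lexx _) h).
  rewrite /D /U -!binomial_mean_interval -!binomial_meanD -[leLHS](binomial_mean1 p m).
  apply: le_binomial_mean => // k _.
  have [k1|k1] := ltnP k (c.+1 - J).
    rewrite [X in _ <= _ + X](_ : _ = 1) ?lerDr ?addr_ge0//.
    rewrite (_ : (J%:R <= _) = true)// ler_normr opprB.
    have : (k + J)%:R <= c%:R :> R by rewrite ler_nat -ltnS addnC -ltn_subRL.
    by rewrite natrD => ?; apply/orP; right; lra.
  have [k2|k2] := ltnP k c.+1; first by rewrite /= -addrA lerDl.
  have [k3|k3] := ltnP k (c.+1 + J); first by rewrite /= add0r lerDl.
  rewrite (_ : (J%:R <= _) = true) ?lerDr ?addr_ge0// ler_normr.
  have : (c.+1 + J)%:R <= k%:R :> R by rewrite ler_nat.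
  by rewrite natrD => ?; apply/orP; left; lra.
(* [D] and [U] differ by at most [delta] and sum to at least [1 - delta], so both are at least
   [1 / 2 - delta]; conclude with [D <= q <= 1 - U]. *)
have D1 : D <= 1 by lra.
have U1 : U <= 1 by lra.
have {DU} DU : (1 - delta) * D <= U by rewrite (le_trans _ DU)// ler_wpM2r.
have {UD} UD : (1 - delta) * U <= D by rewrite (le_trans _ UD)// ler_wpM2r.
have d0 : 0 <= delta by rewrite (le_trans _ d1)// divr_ge0 ?sqr_ge0// ltW.
have hD : 0 <= delta * D <= delta by rewrite mulr_ge0//= ler_piMr.
have hU : 0 <= delta * U <= delta by rewrite mulr_ge0//= ler_piMr.
case/andP: hD => ? ?; case/andP: hU => ? ?.
by rewrite ler_norml; apply/andP; split; lra.
Qed.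

End BinomialMedian.

(** * Loads of the bins *)

Section ThrowsExpectation.
Variables (R : realType) (n m : nat).
Implicit Types (X Y : throws n m -> R).

Lemma throws_probE (f : throws n m) : throws_prob R f = n%:R^-1 ^+ m.
Proof. by rewrite /throws_prob prodr_const card_ord. Qed.

Lemma throws_prob_ge0 (f : throws n m) : 0 <= throws_prob R f.
Proof. by rewrite throws_probE exprn_ge0// invr_ge0. Qed.

Lemma eq_throws_expectation X Y : X =1 Y -> throws_expectation X = throws_expectation Y.
Proof. by move=> XY; apply: eq_bigr => f _; rewrite XY. Qed.

Lemma le_throws_expectation X Y : (forall f, X f <= Y f) ->
  throws_expectation X <= throws_expectation Y.
Proof. by move=> XY; apply: ler_sum => f _; rewrite ler_wpM2l// throws_prob_ge0. Qed.

Lemma throws_expectationD X Y :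
  throws_expectation (fun f => X f + Y f) = throws_expectation X + throws_expectation Y.
Proof. by rewrite -big_split; apply: eq_bigr => f _; rewrite mulrDr. Qed.

Lemma throws_expectationZ c X :
  throws_expectation (fun f => c * X f) = c * throws_expectation X.
Proof. by rewrite /throws_expectation mulr_sumr; apply: eq_bigr => f _; rewrite mulrCA. Qed.

Lemma throws_expectationB X Y :
  throws_expectation (fun f => X f - Y f) = throws_expectation X - throws_expectation Y.
Proof.
rewrite -mulN1r -throws_expectationZ -throws_expectationD.
by apply: eq_throws_expectation => f; rewrite mulN1r.
Qed.

Lemma throws_expectation_sum (I : finType) (F : I -> throws n m -> R) :
  throws_expectation (fun f => \sum_i F i f) = \sum_i throws_expectation (F i).
Proof. by rewrite exchange_big; apply: eq_bigr => f _; rewrite mulr_sumr. Qed.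

Lemma loadE (f : throws n m) (b : 'I_n) : load f b = (\sum_(x < m) (f x == b))%N.
Proof.
rewrite /load -sum1_card big_mkcond; apply: eq_bigr => x _.
by rewrite inE; case: (f x == b).
Qed.

End ThrowsExpectation.

Definition ball_cons (n m : nat) (b : 'I_n) (f : throws n m) : throws n m.+1 :=
  [ffun x => oapp f b (unlift ord0 x)].

Lemma load_ball_cons (n m : nat) (b c : 'I_n) (f : throws n m) :
  load (ball_cons b f) c = ((b == c) + load f c)%N.
Proof.
rewrite !loadE big_ord_recl ffunE unlift_none; congr (_ + _)%N.
by apply: eq_bigr => x _; rewrite ffunE liftK.
Qed.

(** Conditioning on the bin of the first ball, the engine of all inductions on the number of
    balls. *)
Lemma throws_expectation_recl (R : realType) (n m : nat) (X : throws n m.+1 -> R) :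
  throws_expectation X =
  n%:R^-1 * \sum_(b < n) throws_expectation (fun f => X (ball_cons b f)).
Proof.
rewrite /throws_expectation.
pose cons (bf : 'I_n * throws n m) := ball_cons bf.1 bf.2.
pose uncons (f : throws n m.+1) := (f ord0, [ffun x => f (lift ord0 x)] : throws n m).
have consK : cancel cons uncons.
  move=> [b f]; rewrite /uncons /cons ffunE unlift_none /=; congr pair.
  by apply/ffunP => x; rewrite !ffunE liftK.
have unconsK : cancel uncons cons.
  move=> f; apply/ffunP => x; rewrite /cons /uncons ffunE /=.
  by case: unliftP => [y|] -> //=; rewrite ffunE.
rewrite (reindex cons) /=; last by apply: onW_bij; exists uncons.
rewrite mulr_sumr.
under [RHS]eq_bigr do rewrite mulr_sumr.
rewrite pair_bigA /=; apply: eq_bigr => -[b f] _.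
by rewrite !throws_probE exprS mulrA.
Qed.

Lemma throws_expectation0 (R : realType) (n : nat) (X : throws n 0 -> R) (x : R) :
  (forall f, X f = x) -> throws_expectation X = x.
Proof.
move=> Xx; rewrite /throws_expectation.
under eq_bigr do rewrite throws_probE expr0 mul1r Xx.
by rewrite sumr_const card_ffun !card_ord expn0.
Qed.

(** * Law of total loads, negative correlation, and the minimal load *)

Section Loads.
Variables (R : realType) (n : nat).
Hypothesis n_gt0 : (0 < n)%N.

Let n0 : 0 < n%:R :> R. Proof. by rewrite ltr0n. Qed.

(** The first ball hits [B] with probability [#|B| / n], so both sides obey the recursion
    [binomial_meanS]. *)
Lemma throws_binomial (m : nat) (B : {set 'I_n}) (g : nat -> R) :
  throws_expectation (fun f : throws n m => g (\sum_(b in B) load f b)%N) =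
  binomial_mean m (#|B|%:R / n%:R) g.
Proof.
elim: m g => [|m IH] g.
  rewrite binomial_mean0; apply: throws_expectation0 => f.
  by rewrite big1// => b _; rewrite loadE big_ord0.
rewrite throws_expectation_recl binomial_meanS -!IH.
set E1 := throws_expectation _; set E0 := throws_expectation _.
have E b : throws_expectation (fun f : throws n m =>
    g (\sum_(c in B) load (ball_cons b f) c)%N) = E0 + (b \in B)%:R * (E1 - E0).
  have S f : (\sum_(c in B) load (ball_cons b f) c =
      (b \in B) + \sum_(c in B) load f c)%N.
    under eq_bigr do rewrite load_ball_cons.
    rewrite big_split /=; congr (_ + _)%N.
    case: (boolP (b \in B)) => bB.
      rewrite (bigD1 b)//= eqxx big1// => c /andP[_]; rewrite eq_sym.
      by move/negbTE->.
    by rewrite big1// => c cB; case: eqP => // bc; rewrite bc cB in bB.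
  under eq_throws_expectation do rewrite S.
  by case: (b \in B); rewrite ?mul1r ?mul0r ?addr0 ?subrKC.
under eq_bigr do rewrite E.
rewrite big_split /= sumr_const card_ord -mulr_suml -natr_sum.
rewrite -big_mkcond /= sum1_card -mulr_natl.
by field; rewrite gt_eqF.
Qed.

Lemma throws_expectation1 (m : nat) : throws_expectation (fun _ : throws n m => 1 : R) = 1.
Proof. by rewrite (throws_binomial m finset.set0 (fun=> 1)) binomial_mean1. Qed.

Lemma throws_binomial1 (m : nat) (b : 'I_n) (g : nat -> R) :
  throws_expectation (fun f : throws n m => g (load f b)) =
  binomial_mean m (1 / n%:R) g.
Proof.
have := throws_binomial m [set b]%SET g; rewrite cards1 => <-.
by apply: eq_throws_expectation => f; rewrite big_set1.
Qed.

(* Induction on the number of balls: moving one ball keeps the covariance of two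
   monotone functions of distinct loads nonpositive. *)
Lemma load_negative_correlation (m : nat) (b c : 'I_n) (F G : nat -> R) : b != c ->
  (forall k, F k.+1 <= F k) -> (forall k, G k.+1 <= G k) ->
  throws_expectation (fun f : throws n m => F (load f b) * G (load f c)) <=
  throws_expectation (fun f : throws n m => F (load f b)) *
  throws_expectation (fun f : throws n m => G (load f c)).
Proof.
move=> bc; elim: m F G => [|m IH] F G Fd Gd.
  have l0 (f : throws n 0) d : load f d = 0%N by rewrite loadE big_ord0.
  rewrite (@throws_expectation0 _ _ _ (F 0%N * G 0%N)); last by move=> f; rewrite !l0.
  rewrite (@throws_expectation0 _ _ _ (F 0%N)); last by move=> f; rewrite !l0.
  by rewrite (@throws_expectation0 _ _ _ (G 0%N)) // => f; rewrite !l0.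
have n2 : (2 <= n)%N.
  rewrite -[n]card_ord; apply: leq_trans (max_card (pred2 b c)).
  by rewrite card2 bc.
have indicator_sum (d : 'I_n) (y : R) : \sum_(i < n) (i == d)%:R * y = y.
  rewrite (bigD1 d)//= eqxx mul1r big1 ?addr0// => i /negbTE->.
  by rewrite mul0r.
(* The first ball hits [b], hits [c], or misses both; the first two cases appear as corrections to
   the third. *)
have joint : throws_expectation (fun f : throws n m.+1 => F (load f b) * G (load f c)) =
    n%:R^-1 * (n%:R * throws_expectation (fun f : throws n m => F (load f b) * G (load f c))
    + (throws_expectation (fun f : throws n m => F (load f b).+1 * G (load f c))
       - throws_expectation (fun f : throws n m => F (load f b) * G (load f c)))
    + (throws_expectation (fun f : throws n m => F (load f b) * G (load f c).+1)
       - throws_expectation (fun f : throws n m => F (load f b) * G (load f c)))).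
  rewrite throws_expectation_recl; congr (_ * _).
  set e := throws_expectation (fun f => F (load f b) * G (load f c)).
  set e1 := throws_expectation (fun f => F (load f b).+1 * G (load f c)).
  set e2 := throws_expectation (fun f => F (load f b) * G (load f c).+1).
  rewrite -[n in n%:R * e]card_ord mulr_natl -sumr_const.
  rewrite -[e1 - e](indicator_sum b) -[e2 - e](indicator_sum c) -!big_split /=.
  apply: eq_bigr => i _.
  under eq_throws_expectation do rewrite !load_ball_cons.
  have [->|ib] := eqVneq i b; first by rewrite (negbTE bc) mul0r mul1r addr0 subrKC.
  by case: eqVneq => _; rewrite !mul0r ?mul1r !addr0 ?subrKC.
have mean_recl (H : nat -> R) (d : 'I_n) : throws_expectation (fun f : throws n m.+1 => H (load f d)) =
    n%:R^-1 * throws_expectation (fun f : throws n m => H (load f d).+1) +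
    (1 - n%:R^-1) * throws_expectation (fun f : throws n m => H (load f d)).
  by rewrite (throws_binomial1 m.+1 d H) binomial_meanS div1r
    -[n%:R^-1]div1r -(throws_binomial1 m d H) -(throws_binomial1 m d (fun k => H k.+1)).
rewrite joint !mean_recl.
have h0 := IH F G Fd Gd.
have h1 := IH (fun k => F k.+1) G (fun k => Fd k.+1) Gd.
have h2 := IH F (fun k => G k.+1) Fd (fun k => Gd k.+1).
have hF : throws_expectation (fun f : throws n m => F (load f b).+1) <=
  throws_expectation (fun f : throws n m => F (load f b)).
  by apply: le_throws_expectation => f.
have hG : throws_expectation (fun f : throws n m => G (load f c).+1) <=
  throws_expectation (fun f : throws n m => G (load f c)).
  by apply: le_throws_expectation => f.
move: h0 h1 h2 hF hG.
set e := throws_expectation _; set f := throws_expectation _; set g := throws_expectation _.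
set e1 := throws_expectation _; set f' := throws_expectation _.
set e2 := throws_expectation _; set g' := throws_expectation _.
move=> h0 h1 h2 hF hG.
have x0 : 0 <= n%:R^-1 :> R by rewrite invr_ge0.
(* The probability of missing both bins; it must be nonnegative for the induction hypothesis to be
   scaled by it. *)
have x2 : 0 <= 1 - 2 * n%:R^-1 :> R.
  by rewrite subr_ge0 ler_pdivrMr// mul1r ler_nat.
rewrite !mulrDr mulrA mulVf ?gt_eqF// mul1r.
set x := n%:R^-1 in x0 x2 *.
apply: (@le_trans _ _ ((1 - 2 * x) * (f * g) + x * (f' * g) + x * (f * g'))).
  have := ler_wpM2l x2 h0; have := ler_wpM2l x0 h1; have := ler_wpM2l x0 h2; lra.
(* The slack is a product of two decrements, both nonnegative since [F] and [G] are
   nonincreasing. *)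
rewrite -subr_ge0 (_ : _ - _ = x ^+ 2 * ((f - f') * (g - g'))); last by ring.
by rewrite mulr_ge0 ?sqr_ge0// mulr_ge0// subr_ge0.
Qed.

(** Second moment method for the number of bins with load at most [a]: its mean is [n * th], its
    variance is at most [n * th] by negative correlation, and the event says that this number is
    [0]. *)
Lemma min_load_le_whp (m : nat) (a theta : R) : 0 < theta ->
  theta <= binomial_mean m (1 / n%:R) (fun k => (k%:R <= a)%R%:R) ->
  throws_expectation (fun f : throws n m => [forall b, a < (load f b)%:R]%R%:R) <=
  1 / (n%:R * theta).
Proof.
move=> th0; set th := binomial_mean _ _ _ => thle.
have th'0 : 0 < th by exact: lt_le_trans thle.
apply: (@le_trans _ _ (1 / (n%:R * th))); last first.
  by rewrite !div1r lef_pV2 ?posrE ?mulr_gt0// ler_pM2l.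
pose I (b : 'I_n) (f : throws n m) : R := ((load f b)%:R <= a)%R%:R.
have EI b : throws_expectation (I b) = th.
  exact: (throws_binomial1 m b (fun k => (k%:R <= a)%R%:R)).
have EII b c : throws_expectation (fun f => I b f * I c f) <= (b == c)%:R * th + th ^+ 2.
  have [->|bc] := eqVneq b c.
    rewrite mul1r -[X in X <= _]addr0 lerD ?sqr_ge0// -(EI c).
    apply: le_throws_expectation => f; rewrite /I.
    by case: (_ <= a); rewrite ?mulr1 ?mulr0.
  rewrite mul0r add0r expr2 -{1}(EI b) -(EI c).
  have Id k : (k.+1%:R <= a)%R%:R <= (k%:R <= a)%R%:R :> R.
    rewrite ler_nat; case: (leP k.+1%:R a) => //= ka.
    by rewrite (le_trans _ ka)// ler_nat.
  exact: (load_negative_correlation (F := fun k => (k%:R <= a)%R%:R)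
    (G := fun k => (k%:R <= a)%R%:R) m bc Id Id).
have nth : 0 < n%:R * th by rewrite mulr_gt0.
rewrite div1r -[(_ * th)^-1]mul1r ler_pdivlMr// mulrC.
rewrite -(ler_pM2l nth) mulr1 mulrA -expr2 -throws_expectationZ.
rewrite [leRHS](_ : _ = n%:R * th + (n%:R * th) ^+ 2 + (n%:R * th) ^+ 2 -
  (2 * n%:R * th) * (n%:R * th)); last by ring.
(* On the event the squared deviation equals [(n * th) ^+ 2], so its expectation dominates the left
   side. *)
apply: (@le_trans _ _ (throws_expectation (fun f => (n%:R * th - \sum_b I b f) ^+ 2))).
  apply: le_throws_expectation => f.
  case: (boolP [forall b, _]) => [/forallP Ia|_]; last by rewrite mulr0 sqr_ge0.
  rewrite mulr1 big1 ?subr0// => b _.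
  by rewrite /I leNgt Ia.
have Esum : throws_expectation (fun f => \sum_b I b f) = n%:R * th.
  rewrite throws_expectation_sum; under eq_bigr do rewrite EI.
  by rewrite sumr_const card_ord mulr_natl.
have Esq : throws_expectation (fun f => (\sum_b I b f) ^+ 2) <= n%:R * th + (n%:R * th) ^+ 2.
  under eq_throws_expectation do rewrite expr2 mulr_suml.
  rewrite throws_expectation_sum.
  under eq_bigr do (under eq_throws_expectation do rewrite mulr_sumr).
  under eq_bigr do rewrite throws_expectation_sum.
  apply: (@le_trans _ _ (\sum_(b < n) \sum_(c < n) ((b == c)%:R * th + th ^+ 2))).
    by apply: ler_sum => b _; apply: ler_sum => c _; exact: EII.
  rewrite le_eqVlt; apply/orP; left; apply/eqP.
  under eq_bigr => b _.
    rewrite big_split /= (bigD1 b)//= eqxx mul1r big1 => [|i ib]; last first.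
      by rewrite eq_sym (negbTE ib) mul0r.
    rewrite addr0 sumr_const card_ord -[X in _ + X]mulr_natl; over.
  by rewrite sumr_const card_ord -[LHS]mulr_natl; ring.
rewrite (@eq_throws_expectation _ _ _ _ (fun f => ((n%:R * th) ^+ 2 +
  (\sum_b I b f) ^+ 2) - (2 * n%:R * th) * \sum_b I b f)); last by move=> f; ring.
rewrite throws_expectationB throws_expectationD throws_expectationZ Esum lerB// addrC lerD//.
rewrite -[X in throws_expectation X](_ : (fun=> (n%:R * th) ^+ 2 * 1) = _); last first.
  by apply/funext => f; rewrite mulr1.
by rewrite throws_expectationZ throws_expectation1 mulr1.
Qed.

End Loads.

(** * Shapley value of the lightest agent *)

Section PrefixAverages.
Variables (R : realType) (n : nat) (w : 'I_n -> R).
Implicit Types (q : R) (s : {perm 'I_n}) (k : nat) (i : 'I_n).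

Definition prefix s k : {set 'I_n} := [set j | (s j < k)%N]%SET.

(** The quantity [c_k] of the overview. *)
Definition prefix_win q k : R :=
  (n`!%:R)^-1 * \sum_(s : {perm 'I_n}) weighted_voting_game w q (prefix s k).

(** The quantity [A k r] of the overview; the normaliser is the number of permutations putting [i]
    at position [r], see [card_pinned]. *)
Definition pinned_win q i k (r : 'I_n) : R :=
  (n.-1`!%:R)^-1 *
  \sum_(s : {perm 'I_n} | s i == r) weighted_voting_game w q (prefix s k).

Lemma weighted_voting_game_ge0 q (S : {set 'I_n}) : 0 <= weighted_voting_game w q S.
Proof. by rewrite /weighted_voting_game; case: ifP. Qed.

Lemma weighted_voting_game_le1 q (S : {set 'I_n}) : weighted_voting_game w q S <= 1.
Proof. by rewrite /weighted_voting_game; case: ifP. Qed.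

Lemma le_weighted_voting_game q q' (S T : {set 'I_n}) :
  (q <= \sum_(j in S) w j -> q' <= \sum_(j in T) w j) ->
  weighted_voting_game w q S <= weighted_voting_game w q' T.
Proof.
rewrite /weighted_voting_game => h.
by case: ifP => [/h ->//|_]; case: ifP.
Qed.

Lemma prefix_perm s i : i |: predecessors s i = prefix s (s i).+1.
Proof.
by apply/setP => j; rewrite /predecessors /prefix !inE ltnS [RHS]leq_eqVlt -(inj_eq (@perm_inj _ s)).
Qed.

Lemma card_prefix s k : (k <= n)%N -> #|prefix s k| = k.
Proof.
move=> kn; rewrite -sum1dep_card.
rewrite (reindex_inj (@perm_inj _ (s^-1)%g)) /=.
under eq_bigl do rewrite permKV.
by rewrite -(big_ord_widen n (fun=> 1%N))// sum_nat_const card_ord muln1.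
Qed.

(** Exchanging the agents at positions [r] and [t] is a bijection between the two index sets. *)
Lemma sum_pinned_tperm (F : {perm 'I_n} -> R) i (r t : 'I_n) :
  \sum_(s : {perm 'I_n} | s i == r) F s =
  \sum_(s : {perm 'I_n} | s i == t) F (s * tperm r t)%g.
Proof.
rewrite (reindex_inj (mulIg (tperm r t))) /=; apply: eq_bigl => s.
by rewrite permM -{2}(tpermR r t) (inj_eq perm_inj).
Qed.

Lemma card_pinned i (r : 'I_n) :
  \sum_(s : {perm 'I_n} | s i == r) (1 : R) = n.-1`!%:R.
Proof.
have n0 : (0 < n)%N by exact: leq_ltn_trans (ltn_ord i).
have : \sum_(s : {perm 'I_n}) (1 : R) = n`!%:R.
  by rewrite sumr_const card_Sn.
rewrite (partition_big (fun s => s i) xpredT) //=.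
under eq_bigr => t _ do rewrite (sum_pinned_tperm _ i t r).
have -> : n`! = (n * n.-1`!)%N by rewrite -{2}(prednK n0) -factS prednK.
rewrite sumr_const card_ord -[LHS]mulr_natl natrM.
by apply: mulfI; rewrite pnatr_eq0 -lt0n.
Qed.

Lemma prefix_win_ge0 q k : 0 <= prefix_win q k.
Proof.
by rewrite mulr_ge0 ?invr_ge0// sumr_ge0// => s _; exact: weighted_voting_game_ge0.
Qed.

Lemma prefix_win_le1 q k : prefix_win q k <= 1.
Proof.
rewrite /prefix_win mulrC ler_pdivrMr ?ltr0n ?fact_gt0// mul1r -card_Sn -sumr_const.
by apply: ler_sum => s _; exact: weighted_voting_game_le1.
Qed.

Section Pinned.
Variable i : 'I_n.

Let n0 : (0 < n)%N. Proof. exact: leq_ltn_trans (ltn_ord i). Qed.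
Let nR : 0 < n%:R :> R. Proof. by rewrite ltr0n. Qed.
Let f0 : 0 < n.-1`!%:R :> R. Proof. by rewrite ltr0n fact_gt0. Qed.
Let factn : n`!%:R = n%:R * n.-1`!%:R :> R.
Proof. by rewrite -natrM -{2}(prednK n0) -factS prednK. Qed.

Lemma prefix_win_pinned q k : n%:R * prefix_win q k = \sum_(r < n) pinned_win q i k r.
Proof.
rewrite /prefix_win (partition_big (fun s : {perm 'I_n} => s i) xpredT) //=.
rewrite factn invfM mulrA mulrA divff ?gt_eqF// mul1r mulr_sumr.
exact: eq_bigr.
Qed.

Lemma shapley_pinned q : n%:R * shapley (weighted_voting_game w q) i =
  \sum_(r < n) (pinned_win q i r.+1 r - pinned_win q i r r).
Proof.
rewrite /shapley (partition_big (fun s : {perm 'I_n} => s i) xpredT) //=.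
rewrite factn invfM mulrA mulrA divff ?gt_eqF// mul1r mulr_sumr.
apply: eq_bigr => r _; rewrite -mulrBr -sumrB; congr (_ * _).
by apply: eq_bigr => s /eqP sir; rewrite prefix_perm sir /predecessors sir.
Qed.

Lemma le_pinned_win q q' k k' (r : 'I_n) :
  (forall s, s i = r -> q <= \sum_(j in prefix s k) w j ->
     q' <= \sum_(j in prefix s k') w j) ->
  pinned_win q i k r <= pinned_win q' i k' r.
Proof.
move=> h; rewrite ler_pM2l ?invr_gt0//.
by apply: ler_sum => s /eqP sir; exact/le_weighted_voting_game/h.
Qed.

Lemma pinned_win_ge0 q k r : 0 <= pinned_win q i k r.
Proof.
rewrite mulr_ge0 ?invr_ge0 ?(ltW f0)//.
by apply: sumr_ge0 => s _; exact: weighted_voting_game_ge0.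
Qed.

Lemma pinned_win_le1 q k r : pinned_win q i k r <= 1.
Proof.
rewrite /pinned_win mulrC ler_pdivrMr// mul1r -(card_pinned i r).
by apply: ler_sum => s _; exact: weighted_voting_game_le1.
Qed.

Lemma pinned_win_eq0 q k r : (forall s, \sum_(j in prefix s k) w j < q) ->
  pinned_win q i k r = 0.
Proof.
move=> h; rewrite /pinned_win big1 ?mulr0// => s _.
by rewrite /weighted_voting_game leNgt h.
Qed.

Lemma pinned_win_eq1 q k r : (forall s, q <= \sum_(j in prefix s k) w j) ->
  pinned_win q i k r = 1.
Proof.
move=> h; rewrite /pinned_win; under eq_bigr do rewrite /weighted_voting_game h.
by rewrite card_pinned mulVf ?gt_eqF.
Qed.

Hypothesis w_min : forall j, w i <= w j.

(* Swapping [i] with the agent at position [t] only replaces the lightest agent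
   of a prefix, or nothing. *)
Lemma pinned_win_swap q k (r t : 'I_n) : (r < k)%N || (k <= t)%N ->
  pinned_win q i k r <= pinned_win q i k t.
Proof.
move=> rt; rewrite ler_pM2l ?invr_gt0// (sum_pinned_tperm _ i r t).
apply: ler_sum => s /eqP sit; apply: le_weighted_voting_game => /le_trans; apply.
have [rk|kr] := ltnP r k; have [tk|kt] := ltnP t k.
- rewrite (_ : prefix (s * _)%g k = prefix s k)//.
  apply/setP => j; rewrite !inE permM.
  by case: tpermP => [->|->|//]; rewrite rk tk.
(* The only case where the prefixes differ: [i] on the left is replaced by the agent [j], which is
   at least as heavy. *)
- have [j sj] : exists j, s j = r by exists (s^-1 r)%g; rewrite permKV.
  rewrite (bigD1 i) ?inE ?permM ?sit ?tpermR//=.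
  rewrite [leRHS](bigD1 j) ?inE ?sj//= lerD//.
  rewrite le_eqVlt (_ : _ == _)//; apply/eqP/eq_bigl => h; rewrite !inE permM.
  have [->|hi] := eqVneq h i.
    by rewrite andbF sit (ltnNge t) kt.
  have [->|hj] := eqVneq h j; first by rewrite sj tpermL (ltnNge t) kt andbF.
  by rewrite tpermD // eq_sym -?sit -?sj (inj_eq perm_inj).
- by move: rt; rewrite ltnNge kr leqNgt tk.
- rewrite (_ : prefix (s * _)%g k = prefix s k)//.
  apply/setP => j; rewrite !inE permM.
  by case: tpermP => [->|->|//]; rewrite !ltnNge kr kt.
Qed.

(** [prefix_win] averages [pinned_win] over the position of [i], and by swapping, a position inside
    the prefix gives the smallest term, one outside the largest. *)
Lemma pinned_le_prefix_win q k (r : 'I_n) : (r < k)%N ->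
  pinned_win q i k r <= prefix_win q k.
Proof.
move=> rk; rewrite -(ler_pM2l nR) prefix_win_pinned mulr_natl -[n in _ *+ n]card_ord.
by rewrite -sumr_const; apply: ler_sum => t _; rewrite pinned_win_swap// rk.
Qed.

Lemma prefix_win_le_pinned q k (r : 'I_n) : (k <= r)%N ->
  prefix_win q k <= pinned_win q i k r.
Proof.
move=> kr; rewrite -(ler_pM2l nR) prefix_win_pinned mulr_natl -[n in _ *+ n]card_ord.
by rewrite -sumr_const; apply: ler_sum => t _; rewrite pinned_win_swap// kr orbT.
Qed.

(** All but [r] of the [n] averaged positions lie outside the prefix and give at least the left
    side; each of the others loses at most [1]. *)
Lemma pinned_win_le_add q (r : 'I_n) :
  pinned_win q i r r <= prefix_win q r + r%:R / n%:R.
Proof.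
rewrite -(ler_pM2l nR) mulrDr [_ * (_ / _)]mulrC divfK ?gt_eqF// prefix_win_pinned.
rewrite mulr_natl -[n in _ *+ n]card_ord -sumr_const.
have -> : r%:R = \sum_(t < n) (t < r)%N%:R :> R.
  rewrite -natr_sum -big_mkcond /= -(big_ord_widen n (fun=> 1%N)) ?(ltnW (ltn_ord r))//.
  by rewrite sum_nat_const card_ord muln1.
rewrite -big_split; apply: ler_sum => t _ /=.
have [tr|rt] := ltnP t r; last by rewrite addr0 pinned_win_swap// rt orbT.
by rewrite (le_trans (pinned_win_le1 _ _ _))// lerDr pinned_win_ge0.
Qed.

Hypothesis w_ge0 : forall j, 0 <= w j.

Lemma shapley_ge0 q : 0 <= n%:R * shapley (weighted_voting_game w q) i.
Proof.
rewrite shapley_pinned; apply: sumr_ge0 => r _; rewrite subr_ge0.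
apply: le_pinned_win => s _ /le_trans; apply.
rewrite big_mkcond [leRHS]big_mkcond; apply: ler_sum => j _; rewrite !inE.
by have [jr|_] := ltnP (s j) r; [rewrite ltnW | case: ifP].
Qed.

Lemma shapley_min_le1 q : n%:R * shapley (weighted_voting_game w q) i <= 1.
Proof.
rewrite shapley_pinned.
apply: (@le_trans _ _ (\sum_(r < n) (prefix_win q r.+1 - prefix_win q r))).
  by apply: ler_sum => r _; rewrite lerB ?pinned_le_prefix_win ?prefix_win_le_pinned.
rewrite -(big_mkord xpredT (fun r => prefix_win q r.+1 - prefix_win q r)).
rewrite telescope_sumr//.
have := prefix_win_le1 q n; have := prefix_win_ge0 q 0; lra.
Qed.

(** Only sets of size [l] are undecided, so [i] can be pivotal only at positions [l - 1] and [l].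
    The threshold [x] is for the former: either [i] weighs more than [x], or the [l - 1] agents
    before it weigh at least [q - x] whenever they win together with [i]. *)
Lemma shapley_min_bounds q (x : R) (l : nat) :
  (0 < l < n)%N ->
  (forall S : {set 'I_n}, (#|S| < l)%N -> \sum_(j in S) w j < q) ->
  (forall S : {set 'I_n}, (l < #|S|)%N -> q <= \sum_(j in S) w j) ->
  1 - prefix_win q l - l%:R / n%:R <= n%:R * shapley (weighted_voting_game w q) i <=
  1 - prefix_win q l + (x < w i)%R%:R + prefix_win (q - x) l.-1 + l%:R / n%:R.
Proof.
case: l => // l /= ln small large; have ln' := ltnW ln.
(* From here on [l] is one less than in the statement; [r] and [t] are the two possibly pivotal
   positions. *)
pose r := Ordinal ln'; pose t := Ordinal ln.
have rt : t != r by rewrite -val_eqE /= gtn_eqF.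
have -> : n%:R * shapley (weighted_voting_game w q) i =
    pinned_win q i l.+1 r + (1 - pinned_win q i l.+1 t).
  rewrite shapley_pinned (bigD1 r)//= (bigD1 t)//=.
  rewrite (@pinned_win_eq0 q l r); last first.
    by move=> s; apply: small; rewrite card_prefix// ltnW.
  rewrite (@pinned_win_eq1 q l.+2 t); last first.
    by move=> s; apply: large; rewrite card_prefix.
  rewrite subr0 big1 ?addr0// => u /andP[ur ut].
  have below (k : nat) : (k <= l)%N -> pinned_win q i k u = 0.
    move=> kl; apply: pinned_win_eq0 => s; apply: small.
    by rewrite card_prefix// (leq_trans kl)// ltnW.
  have above (k : nat) : (l.+1 < k <= n)%N -> pinned_win q i k u = 1.
    move=> /andP[lk kn]; apply: pinned_win_eq1 => s; apply: large.
    by rewrite card_prefix.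
  have [ul|lu] := ltnP u l; first by rewrite !below ?subrr// ltnW.
  have lu' : (l.+1 < u)%N.
    by rewrite ltn_neqAle eq_sym ut /= ltn_neqAle eq_sym ur.
  by rewrite !above ?subrr// ?lu' ?(leqW lu') ?ltn_ord// ltnW.
have r0 := pinned_win_ge0 q l.+1 r.
have t1 := pinned_win_le_add q t; have t2 := @prefix_win_le_pinned q l.+1 t (leqnn _).
have r1 : pinned_win q i l.+1 r <= (x < w i)%R%:R + pinned_win (q - x) i l r.
  case: (ltP x (w i)) => [_|wix].
    by rewrite (le_trans (pinned_win_le1 _ _ _))// lerDl pinned_win_ge0.
  rewrite add0r; apply: le_pinned_win => s sir.
  have -> : l.+1 = (s i).+1 by rewrite sir.
  rewrite -prefix_perm big_setU1 /= ?inE ?ltnn// /predecessors sir => h.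
  rewrite lerBlDr (le_trans h)// addrC lerD2l.
  by [].
have r2 := pinned_win_le_add (q - x) r.
have lr : r%:R / n%:R <= l.+1%:R / n%:R :> R by rewrite ler_pM2r ?invr_gt0// ler_nat.
rewrite /= in t1 r2 lr *.
by apply/andP; split; lra.
Qed.

End Pinned.

End PrefixAverages.

Lemma sorted_load_perm (n m : nat) (f : throws n m) :
  exists u : {perm 'I_n}, forall i, sorted_load f i = load f (u i).
Proof.
have : perm_eq (sort leq [seq load f b | b <- enum 'I_n]) [tuple load f b | b < n].
  by rewrite perm_sort; exact: perm_refl.
case/tuple_permP => u E; exists u => i.
by rewrite /sorted_load E -tnth_nth !tnth_mktuple.
Qed.

Lemma sorted_load_min (n' m : nat) (f : throws n'.+1 m) (j : 'I_n'.+1) :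
  (sorted_load f ord0 <= sorted_load f j)%N.
Proof.
rewrite /sorted_load; apply: sorted_leq_nth => //.
- exact: leq_trans.
- exact/sort_sorted/leq_total.
- by rewrite inE size_sort size_map size_enum_ord.
- by rewrite inE size_sort size_map size_enum_ord.
Qed.

(** An average over all orders ignores labels, so the sorted loads may be replaced by the raw ones,
    whose law is known. *)
Lemma prefix_win_perm (R : realType) (n : nat) (w : 'I_n -> R) (u : {perm 'I_n})
    (q : R) (k : nat) :
  prefix_win (fun i => w (u i)) q k = prefix_win w q k.
Proof.
rewrite /prefix_win (reindex_inj (mulgI u)) /=; congr (_ * _).
apply: eq_bigr => s _; rewrite /weighted_voting_game.
rewrite (_ : \sum_(j in prefix (u * s)%g k) w (u j) = \sum_(j in prefix s k) w j)//.
rewrite [RHS](reindex_inj (@perm_inj _ u)) /=.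
by apply: eq_bigl => j; rewrite !inE permM.
Qed.

(** * Averaging the Shapley bounds over the loads *)

Section ExpectedShapley.
Variables (R : realType) (n' m : nat).
Let n := n'.+1.
Let lam : R := m%:R / n%:R.

Let nR : 0 < n%:R :> R. Proof. by rewrite ltr0n. Qed.

Lemma expected_prefix_win (q : R) (k : nat) : (k <= n)%N ->
  throws_expectation (fun f : throws n m => prefix_win (fun b => (load f b)%:R) q k) =
  binomial_mean m (k%:R / n%:R) (fun j => (q <= j%:R)%R%:R).
Proof.
move=> kn; rewrite throws_expectationZ throws_expectation_sum.
transitivity ((n`!%:R)^-1 * \sum_(s : {perm 'I_n})
    binomial_mean m (k%:R / n%:R) (fun j => (q <= j%:R)%R%:R : R)).
  congr (_ * _); apply: eq_bigr => s _.
  have := throws_binomial (ltn0Sn n') m (prefix s k) (fun j => (q <= j%:R)%R%:R : R).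
  rewrite card_prefix// => <-; apply: eq_throws_expectation => f.
  by rewrite /weighted_voting_game natr_sum; case: ifP.
by rewrite sumr_const card_Sn -[X in _ * X]mulr_natl mulrA mulVf ?mul1r// pnatr_eq0 -lt0n fact_gt0.
Qed.

Definition balanced (tau : R) (f : throws n m) : bool :=
  [forall b, `|(load f b)%:R - lam| <= tau].

(** Union bound over [n] bins, each load having variance at most [m / n]. *)
Lemma unbalanced_prob (tau : R) : 0 < tau ->
  throws_expectation (fun f => (~~ balanced tau f)%:R : R) <= m%:R / tau ^+ 2.
Proof.
move=> tau0.
have p01 : 0 <= (1 / n%:R : R) <= 1.
  by rewrite divr_ge0//= ler_pdivrMr// mul1r ler1n.
apply: (@le_trans _ _ (throws_expectation (fun f : throws n m =>
    \sum_(b < n) (tau < `|(load f b)%:R - lam|)%R%:R))).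
  apply: le_throws_expectation => f; rewrite /balanced negb_forall.
  case: existsP => [[b]|_]; last by apply: sumr_ge0.
  by rewrite -ltNge => h; rewrite (bigD1 b)//= h lerDl sumr_ge0.
rewrite throws_expectation_sum.
apply: (@le_trans _ _ (\sum_(b < n) m%:R * (1 / n%:R) / tau ^+ 2)).
  apply: ler_sum => b _.
  rewrite (throws_binomial1 (ltn0Sn n') m b (fun k => (tau < `|k%:R - lam|)%R%:R)).
  apply: (le_trans (@binomial_chebyshev R _ p01 m tau (fun k => tau < `|k%:R - lam|) tau0 _)).
    by move=> k /ltW; rewrite div1r.
  by rewrite ler_pM2r ?invr_gt0 ?exprn_gt0// ler_piMr ?mulr_ge0 ?divr_ge0//.
rewrite sumr_const card_ord -[leLHS]mulr_natl mulrA (_ : n%:R * _ = m%:R)//.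
by field; rewrite gt_eqF.
Qed.

Variables (l : nat).
Hypotheses (l_n : (0 < l < n)%N) (m_gt0 : (0 < m)%N).

Let lam0 : 0 < lam. Proof. by rewrite divr_gt0// ltr0n. Qed.
Let l2 : 0 < l%:R + 2 :> R. Proof. by rewrite ltr_wpDl. Qed.
(** Chosen so that [(l - 1) (lam + tau) < q < (l + 1) (lam - tau)]: on balanced outcomes only sets
    of size [l] are undecided. *)
Let tau : R := lam / (l%:R + 2).
Let tau0 : 0 < tau. Proof. by rewrite divr_gt0. Qed.
Let tauE : tau * (l%:R + 2) = lam. Proof. by rewrite divfK// gt_eqF. Qed.
Let q : R := l%:R * lam.

Let phi (f : throws n m) : R := n%:R *
  shapley (weighted_voting_game (fun i => (sorted_load f i)%:R) q) ord0.

Let c (f : throws n m) (y : R) (k : nat) : R := prefix_win (fun b => (load f b)%:R) y k.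

(** On unbalanced outcomes the indicator makes both bounds follow from [0 <= phi f <= 1]. *)
Lemma shapley_balanced (x : R) (f : throws n m) :
  1 - c f q l - l%:R / n%:R - (~~ balanced tau f)%:R <= phi f <=
  1 - c f q l + [forall b, x < (load f b)%:R]%R%:R + c f (q - x) l.-1 + l%:R / n%:R
    + (~~ balanced tau f)%:R.
Proof.
have [u fu] := sorted_load_perm f.
pose w i : R := (sorted_load f i)%:R.
have wu : w = (fun i => (load f (u i))%:R) by apply/funext => i; rewrite /w fu.
have cw y k : c f y k = prefix_win w y k.
  by rewrite wu /c (prefix_win_perm (fun b => (load f b)%:R) u).
have wmin j : w ord0 <= w j by rewrite ler_nat sorted_load_min.
have w0 j : 0 <= w j by [].
have c0 y k : 0 <= c f y k by rewrite cw prefix_win_ge0.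
have c1 y k : c f y k <= 1 by rewrite cw prefix_win_le1.
have ln0 : 0 <= l%:R / n%:R :> R by rewrite divr_ge0.
have x0 : 0 <= [forall b, x < (load f b)%:R]%R%:R :> R by [].
case: (boolP (balanced tau f)) => /= [/forallP bal|_]; last first.
  have := shapley_ge0 ord0 w0 q; have := shapley_min_le1 wmin q.
  rewrite -/(phi f) => h1 h2.
  have := c0 q l; have := c1 q l; have := c0 (q - x) l.-1; have := x0; have := ln0.
  by move=> ? ? ? ? ?; apply/andP; split; lra.
have bw i : lam - tau <= w i <= lam + tau.
  by have := bal (u i); rewrite -fu ler_distl.
have := @shapley_min_bounds R n w ord0 wmin q x l l_n.
have lS (S : {set 'I_n}) : \sum_(j in S) w j <= #|S|%:R * (lam + tau).
  rewrite mulr_natl -sumr_const; apply: ler_sum => j _.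
  by case/andP: (bw j).
have gS (S : {set 'I_n}) : #|S|%:R * (lam - tau) <= \sum_(j in S) w j.
  rewrite mulr_natl -sumr_const; apply: ler_sum => j _.
  by case/andP: (bw j).
have t0 := tau0; have tE := tauE; have la0 := lam0.
move=> /(_ _ _)/[!subr0]/[!addr0] H.
have -> : [forall b, x < (load f b)%:R]%R = (x < w ord0).
  apply/forallP/idP => [h|h b].
    by rewrite wu.
  by rewrite (lt_le_trans h)// (le_trans (wmin (u^-1 b)%g))// wu permKV.
rewrite !cw; apply: H => S hS.
- apply: le_lt_trans (lS S) _.
  have hS' : #|S|%:R + 1 <= l%:R :> R by rewrite natr1 ler_nat.
  apply: (@le_lt_trans _ _ ((l%:R - 1) * (lam + tau))).
    by rewrite ler_pM2r ?addr_gt0// lerBrDr.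
  by rewrite /q; lra.
- apply: le_trans (gS S).
  have hS' : l%:R + 1 <= #|S|%:R :> R by rewrite natr1 ler_nat.
  apply: (@le_trans _ _ ((l%:R + 1) * (lam - tau))).
    by rewrite /q; lra.
  rewrite ler_wpM2r// subr_ge0.
  have := mulr_ge0 (ltW t0) (ler0n R l); lra.
Qed.

(** The four errors come from unbalanced loads, from unpinning the lightest agent, from a minimal
    load above [lam - t], and from [l - 1] agents exceeding their mean by [t]. *)
Lemma expected_shapley_approx (t theta : R) : 0 < t -> 0 < theta ->
  theta <= binomial_mean m (1 / n%:R) (fun k => (k%:R <= lam - t)%R%:R) ->
  `|n%:R * expected_shapley_min n' m q
    - binomial_mean m (l%:R / n%:R) (fun k => (k%:R < q)%R%:R)| <=
  m%:R / tau ^+ 2 + l%:R / n%:R + 1 / (n%:R * theta) + l%:R * lam / t ^+ 2.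
Proof.
move=> t0 th0 thle; have [l0 ln] := andP l_n.
have p01 (k : nat) : (k <= n)%N -> 0 <= (k%:R / n%:R : R) <= 1.
  by move=> kn; rewrite divr_ge0//= ler_pdivrMr// mul1r ler_nat.
have -> : binomial_mean m (l%:R / n%:R) (fun k => (k%:R < q)%R%:R) =
    1 - binomial_mean m (l%:R / n%:R) (fun k => (q <= k%:R)%R%:R) :> R.
  rewrite -(binomial_meanC _ _ (fun k => q <= k%:R)).
  by apply: eq_binomial_mean => k; rewrite ltNge.
have -> : n%:R * expected_shapley_min n' m q = throws_expectation phi.
  by rewrite throws_expectationZ.
have Hc := expected_prefix_win q (ltnW ln).
have Hc' := expected_prefix_win (q - (lam - t)) (leq_trans (leq_pred l) (ltnW ln)).
have Hmin := min_load_le_whp (ltn0Sn n') th0 thle; rewrite -/n in Hmin.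
have HG := unbalanced_prob tau0.
have Hcheb : binomial_mean m (l.-1%:R / n%:R) (fun j => (q - (lam - t) <= j%:R)%R%:R) <=
    l%:R * lam / t ^+ 2.
  have pl := p01 l.-1 (leq_trans (leq_pred l) (ltnW ln)).
  have E : m%:R * (l.-1%:R / n%:R) = q - lam.
    by rewrite /q -{2}(prednK l0) -natr1 /lam; field; rewrite gt_eqF.
  apply: (le_trans (@binomial_chebyshev R _ pl m t (fun j => q - (lam - t) <= j%:R) t0 _)).
    by move=> k h; rewrite E (le_trans _ (ler_norm _))//; lra.
  rewrite ler_pM2r ?invr_gt0 ?exprn_gt0// E -/q.
  apply: (@le_trans _ _ (q - lam)); last by rewrite lerBlDr lerDl ltW.
  case/andP: pl => pl0 _.
  have ql0 : 0 <= q - lam by rewrite -E mulr_ge0.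
  by rewrite ler_piMr// gerBl.
have cst (y : R) : throws_expectation (fun _ : throws n m => y) = y.
  transitivity (throws_expectation (fun _ : throws n m => y * 1)).
    by apply: eq_throws_expectation => f; rewrite mulr1.
  by rewrite throws_expectationZ (throws_expectation1 R (ltn0Sn n') m) mulr1.
have lower := le_throws_expectation (fun f => proj1 (andP (shapley_balanced (lam - t) f))).
have upper := le_throws_expectation (fun f => proj2 (andP (shapley_balanced (lam - t) f))).
rewrite !throws_expectationB Hc !cst in lower.
rewrite 4!throws_expectationD throws_expectationB Hc Hc' !cst in upper.
have e0 : 0 <= 1 / (n%:R * theta) by rewrite divr_ge0// mulr_ge0// ltW.
have e1 : 0 <= l%:R * lam / t ^+ 2.
  by rewrite divr_ge0 ?mulr_ge0 ?sqr_ge0// ltW.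
move: HG Hmin Hcheb lower upper.
set g := throws_expectation _; set h := throws_expectation _.
set b := binomial_mean _ _ _; set p := binomial_mean _ _ _.
set e := throws_expectation _ => HG Hmin Hcheb lower upper.
by rewrite ler_norml; apply/andP; split; lra.
Qed.

End ExpectedShapley.

(** * Asymptotics *)

Lemma nat_between (R : realType) (x : R) : 0 <= x -> exists k : nat, x <= k%:R <= x + 1.
Proof.
move=> x0; exists (Num.truncn x).+1.
have /andP[h1 h2] := truncn_itv x0.
by rewrite ltW//= -natr1 lerD2r.
Qed.

Lemma nat_below (R : realType) (x : R) : 0 < x -> exists c : nat, c%:R < x <= c.+1%:R.
Proof.
move=> x0; have ex : exists k : nat, x <= k.+1%:R.
  by have [k /andP[h _]] := nat_between (ltW x0); exists k; rewrite (le_trans h)// ler_nat.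
case: (ex_minnP ex) => c xc cmin; exists c; rewrite xc andbT.
case: c cmin {xc} => // c cmin; rewrite ltNge; apply/negP => /cmin.
by rewrite ltnn.
Qed.

(** A half-window [J] of about [M] standard deviations, with [M] depending on [delta] only: the mass
    outside is at most [1 / M ^+ 2], and the reflection error is of order [M ^+ 3 / sd]. *)
Lemma binomial_median_limit (R : realType) (delta : R) : 0 < delta ->
  exists V0 : R, forall (m : nat) (p : R), 0 < p < 1 -> V0 <= m%:R * p * (1 - p) ->
    `|binomial_mean m p (fun k => (k%:R < m%:R * p)%R%:R) - 1 / 2| <= delta.
Proof.
move=> d0; have [M [M1 MM]] : exists M : R, 1 < M /\ 1 / M ^+ 2 <= delta.
  have di0 : 0 < delta^-1 by rewrite invr_gt0.
  exists (delta^-1 + 1); split; first by rewrite ltrDr.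
  rewrite div1r -[leRHS]invrK lef_pV2 ?posrE ?exprn_gt0 ?addr_gt0//.
  by have := mulr_gt0 di0 di0; rewrite expr2; lra.
have M0 : 0 < M by lra.
pose C := (M + 1) * (2 + (M + 1) ^+ 2).
have M10 : 0 < M + 1 by rewrite addr_gt0.
have C0 : 0 < C.
  by apply: mulr_gt0 => //; apply: addr_gt0 => //; apply: exprn_gt0.
(* This forces [sd >= C / delta], which bounds the reflection error, and [sd > M + 1], which gives
   [J < V]. *)
exists ((C / delta + M + 2) ^+ 2) => m p p01 hV.
set V := m%:R * p * (1 - p) in hV; have [p0 p1] := andP p01.
pose sd := Num.sqrt V.
have Cd0 : 0 < C / delta by rewrite divr_gt0.
have B0 : 0 < C / delta + M + 2 by rewrite !addr_gt0.
have V0 : 0 < V by rewrite (lt_le_trans _ hV)// exprn_gt0.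
have sdV : sd ^+ 2 = V by rewrite sqr_sqrtr// ltW.
have sd0 : 0 < sd by rewrite sqrtr_gt0.
have sdB : C / delta + M + 2 <= sd.
  by rewrite -(ler_pXn2r (ltn0Sn 1)) ?nnegrE ?(ltW B0) ?(ltW sd0)// sdV.
have [J /andP[J1 J2]] : exists J : nat, M * sd <= J%:R <= M * sd + 1.
  by apply: nat_between; rewrite mulr_ge0 ?(ltW sd0)//; lra.
have sd1 : 1 <= sd by lra.
have Msd : 0 < M * sd by rewrite mulr_gt0//; lra.
have JM : J%:R <= (M + 1) * sd by rewrite mulrDl mul1r; lra.
have mu0 : 0 < m%:R * p by move: V0; rewrite /V pmulr_lgt0// subr_gt0.
have [c c_mu] := nat_below mu0.
have J0 : 0 < J%:R :> R by exact: lt_le_trans J1.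
apply: (@binomial_median R m p p01 c J delta c_mu).
- by rewrite -(ltr0n R).
- rewrite -/V -sdV expr2 (le_lt_trans JM)// ltr_pM2r//; lra.
- apply: le_trans MM; rewrite -/V div1r ler_pdivrMr ?exprn_gt0//.
  rewrite mulrC ler_pdivlMr ?exprn_gt0//.
  rewrite -sdV -exprMn mulrC lerXn2r ?nnegrE ?(ltW J0)// ltW//.
- rewrite -/V ler_pdivrMr ?exprn_gt0 ?addr_gt0//.
  have JJ : J%:R ^+ 2 <= (M + 1) ^+ 2 * V.
    by rewrite -sdV -exprMn lerXn2r ?nnegrE ?(ltW J0)// (le_trans (ltW J0)).
  apply: (@le_trans _ _ (((M + 1) * sd) * ((2 + (M + 1) ^+ 2) * (V + 1)))).
    rewrite ler_pM ?(ltW J0)//.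
      by rewrite !addr_ge0 ?sqr_ge0// mulr_ge0 ?ltW.
    have := sqr_ge0 (M + 1); lra.
  rewrite (_ : _ * _ = C * sd * (V + 1)); last by rewrite /C; ring.
  rewrite expr2 mulrA ler_pM2r ?addr_gt0//.
  apply: (@le_trans _ _ (delta * V)); last by rewrite ler_pM2l// lerDl.
  rewrite -sdV expr2 mulrA ler_pM2r//.
  by rewrite mulrC -ler_pdivrMr//; lra.
Qed.

Lemma expR_le_1B (R : realType) (x : R) : 0 <= x <= 1 / 2 -> expR (- (2 * x)) <= 1 - x.
Proof.
move=> /andP[x0 x1].
have h : 1 + 2 * x <= expR (2 * x) by exact: expR_ge1Dx.
rewrite expRN -[leRHS]invrK lef_pV2 ?posrE ?expR_gt0 ?invr_gt0//; last by lra.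
apply: le_trans h; rewrite -[leLHS]mul1r ler_pdivrMr; last by lra.
nra.
Qed.

(** [binomial_lower_tail] with a shift [s] of about [t + 2 * sd]. Both [s] and [2 * sd + s + 1] are
    at most [t + 5 * sd], and [2 (t + 5 sd)^2 <= 4 t^2 + 100 sd^2] explains the constants. *)
Lemma binomial_lower_tail_expR (R : realType) (m : nat) (p sd t : R) :
  0 < p < 1 -> sd ^+ 2 = m%:R * p * (1 - p) -> 2 <= sd -> 0 <= t ->
  2 * (t + 5 * sd) <= sd ^+ 2 ->
  3 / 4 * expR (- (4 * t ^+ 2 / sd ^+ 2 + 100)) <=
  binomial_mean m p (fun k => (k%:R <= m%:R * p - t)%R%:R).
Proof.
move=> p01 sdV sd2 t0 tV.
have sd0 : 0 < sd by lra.
have V0 : 0 < sd ^+ 2 by rewrite exprn_gt0.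
have [s /andP[s1 s2]] : exists s : nat, 2 * sd + t <= s%:R <= 2 * sd + t + 1.
  by apply: nat_between; lra.
set x := (2 * sd + s%:R + 1) / sd ^+ 2.
have x0 : 0 <= x by rewrite divr_ge0 ?(ltW V0)//; lra.
have x2 : x <= 1 / 2 by rewrite ler_pdivrMr//; lra.
have := @binomial_lower_tail R m p p01 sd (m%:R * p - t) s sd0 sdV.
rewrite -sdV -/x => h; apply: le_trans (h _ _); [|lra|lra].
rewrite ler_pM2l; last by lra.
apply: (@le_trans _ _ (expR (- (2 * x)) ^+ s)); last first.
  by rewrite lerXn2r ?nnegrE ?expR_ge0 ?expR_le_1B ?x0 ?x2//; lra.
rewrite -expRM_natl ler_expR mulrN lerN2.
have s0 : 0 <= s%:R :> R by [].
apply: (@le_trans _ _ (2 * (t + 5 * sd) ^+ 2 / sd ^+ 2)).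
  rewrite [leLHS](_ : _ = 2 * (s%:R * (2 * sd + s%:R + 1)) / sd ^+ 2); last first.
    by rewrite /x; ring.
  rewrite ler_pM2r ?invr_gt0// ler_pM2l// expr2 ler_pM//; lra.
rewrite ler_pdivrMr// [leRHS](_ : _ = 4 * t ^+ 2 + 100 * sd ^+ 2); last first.
  by field; rewrite gt_eqF.
have := sqr_ge0 (t - 5 * sd); rewrite !expr2; nra.
Qed.

Lemma expected_shapley_min_limit (R : realType) (eps kappa : R) :
  0 < eps -> 0 < kappa ->
  exists L0 eta : R, 0 < eta /\ forall n' m l : nat, let n := n'.+1 in
    L0 <= ln n%:R -> (0 < l)%N -> l%:R <= eta * ln n%:R ->
    kappa * (n%:R ^+ 3 * ln n%:R) <= m%:R ->
    `|n%:R * expected_shapley_min n' m (l%:R * (m%:R / n%:R)) - 1 / 2| <= eps.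
Proof.
move=> eps0 kap0; pose e := eps / 5.
have e0 : 0 < e by rewrite divr_gt0.
have epsE : eps = e + e + e + e + e by rewrite /e; field.
clearbody e.
have [V0 median] := binomial_median_limit e0.
(* With [L = ln n], the summands yield in turn [L >= 200], [L * e >= 3], [L * (kappa * e) >= 18],
   [kappa * L >= 32] and [L >= V0]; the choice of [eta] yields both [l <= L] and
   [16 * l <= e * L]. *)
exists (200 + 3 / e + 18 / (kappa * e) + 32 / kappa + `|V0|), (e / (16 * (1 + e))).
have e1 : 0 < 16 * (1 + e) by rewrite mulr_gt0// addr_gt0.
split; first by rewrite divr_gt0.
move=> n' m l n hL l0 hl hm.
have [x xN] : exists x : R, x = n%:R by exists n%:R.
have [L LE] : exists L, L = ln x by exists (ln x).
have [ll llN] : exists y : R, y = l%:R by exists l%:R.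
have [lam lamN] : exists y : R, y = m%:R / x by exists (m%:R / x).
rewrite -xN -LE -?llN in hL hl hm *; rewrite -lamN.
have xE : x = expR L by rewrite LE lnK// posrE xN ltr0n.
have a1 : 0 < 3 / e by rewrite divr_gt0.
have a2 : 0 < 18 / (kappa * e) by rewrite divr_gt0 ?mulr_gt0.
have a3 : 0 < 32 / kappa by rewrite divr_gt0.
have [L200 Le Lke Lk LV] : [/\ 200 <= L, 198 + 3 / e <= L, 18 / (kappa * e) <= L,
    32 / kappa <= L & V0 <= L].
  move: (normr_ge0 V0) (ler_norm V0) hL a1 a2 a3; clear.
  by set a := 3 / e; set b := 18 / _; set c := 32 / _ => *; split; lra.
have L0 : 0 < L by move: L200; clear; lra.
have Lke' : 18 <= L * (kappa * e) by rewrite -ler_pdivrMr// mulr_gt0.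
have Lk' : 32 <= kappa * L by rewrite mulrC -ler_pdivrMr.
have Le' : 3 <= L * e.
  rewrite -ler_pdivrMr//; move: Le; set a := 3 / e; clear; lra.
clear hL a1 a2 a3 Lke Lk.
have xL2 : L ^+ 2 / 2 <= x.
  rewrite xE; have := expR_ge1Dxn 1 (ltW L0); rewrite (_ : 2`! = 2)//; clear; lra.
have xL : 100 * L <= x.
  by apply: le_trans xL2; move: L200; rewrite expr2; clear; nra.
have Lx : L <= x by move: xL L0; clear; lra.
have x0 : 0 < x by exact: lt_le_trans Lx.
have l1 : 1 <= ll by rewrite llN ler1n.
have ll0 : 0 < ll by exact: lt_le_trans l1.
have hl' : ll * (16 * (1 + e)) <= e * L.
  by move: hl; rewrite mulrAC ler_pdivlMr.
have llL : ll <= L.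
  rewrite -(ler_pM2r e1) (le_trans hl')// [leRHS]mulrC ler_pM2r//.
  by move: e0; clear; lra.
have lle : 16 * ll <= e * L.
  by have := mulr_ge0 (ltW ll0) (ltW e0); move: hl'; clear; lra.
have lamE : m%:R = lam * x by rewrite lamN divfK ?gt_eqF.
have lamL : kappa * (x ^+ 2 * L) <= lam.
  by rewrite lamN ler_pdivlMr// (_ : _ * x = kappa * (x ^+ 3 * L))//; ring.
have lamL2 : 32 * L ^+ 2 <= lam.
  apply: le_trans lamL; rewrite [leRHS](_ : _ = (kappa * L) * x ^+ 2); last by ring.
  by apply: ler_pM; rewrite ?sqr_ge0// ler_pXn2r ?nnegrE ?(ltW L0) ?(ltW x0).
have LL : L <= L ^+ 2.
  by rewrite expr2 ler_peMl ?(ltW L0)// (le_trans _ L200)// ler1n.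
have lam0 : 0 < lam by apply: lt_le_trans lamL2; rewrite mulr_gt0 ?exprn_gt0.
have m0 : (0 < m)%N by rewrite -(ltr0n R) lamE mulr_gt0.
have lx : ll / x <= 1 / 2.
  by rewrite ler_pdivrMr//; move: xL llL L0; clear; lra.
have x1 : 1 / x <= 1 / 2.
  by rewrite ler_pdivrMr//; move: xL L200; clear; lra.
have ln : (l < n)%N.
  by rewrite -(ltr_nat R) -xN -llN; move: xL llL L0; clear; lra.
have half (y : R) : 1 <= y -> y / x <= 1 / 2 -> lam / 2 <= m%:R * (y / x) * (1 - y / x).
  move=> y1 yx; rewrite (_ : m%:R * (y / x) = lam * y); last first.
    by rewrite lamE; field; rewrite gt_eqF.
  apply: (@le_trans _ _ (lam * y * (1 / 2))); last first.
    rewrite ler_pM2l; first by move: yx; clear; lra.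
    by rewrite mulr_gt0// (lt_le_trans _ y1).
  by rewrite mul1r ler_pM2r// ler_peMr// ltW.
have V0lam : V0 <= lam / 2 by move: LV LL lamL2 L0; clear; lra.
pose V1 := m%:R * (1 / x) * (1 - 1 / x).
have V1lam : lam / 2 <= V1 by exact: half.
have V1pos : 0 < V1 by apply: lt_le_trans V1lam; rewrite divr_gt0.
have [sd sd0 sdV] : exists2 sd : R, 0 < sd & sd ^+ 2 = V1.
  by exists (Num.sqrt V1); rewrite ?sqrtr_gt0// sqr_sqrtr// ltW.
have sdL : 4 * L <= sd.
  rewrite -(ler_pXn2r (ltn0Sn 1)) ?nnegrE ?(ltW sd0) ?mulr_ge0 ?(ltW L0)//.
  by rewrite exprMn sdV; move: V1lam lamL2; clear; lra.
have t2 : 0 < ll * lam / e by rewrite divr_gt0// mulr_gt0.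
(* The constant [K] of the overview is [1 / e], which makes the last error equal to [e]. *)
have [t t0 tE] : exists2 t : R, 0 < t & t ^+ 2 = ll * lam / e.
  by exists (Num.sqrt (ll * lam / e)); rewrite ?sqrtr_gt0// sqr_sqrtr// ltW.
(* Smallness of [l] against [ln n] enters here: the tail exponent [4 * t ^+ 2 / sd ^+ 2] is at most
   [L / 2], so [n * theta] below still grows like [expR (L / 2)]. *)
have tsd : t ^+ 2 <= L / 8 * sd ^+ 2.
  rewrite tE ler_pdivrMr// sdV.
  apply: (@le_trans _ _ ((e * L / 16) * lam)).
    by rewrite ler_pM2r//; move: lle; clear; lra.
  have : e * L * (lam / 2) <= e * L * V1 by rewrite ler_pM2l// mulr_gt0.
  clear; lra.
have tL : t <= L * sd.
  rewrite -(ler_pXn2r (ltn0Sn 1)) ?nnegrE ?(ltW t0) ?mulr_ge0 ?(ltW sd0) ?(ltW L0)//.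
  rewrite exprMn; apply: le_trans tsd _; rewrite ler_wpM2r ?sqr_ge0//.
  by move: LL L0; clear; lra.
have cond : 2 * (t + 5 * sd) <= sd ^+ 2.
  have : (2 * (L + 5)) * sd <= sd * sd.
    by rewrite ler_pM2r//; move: sdL L200; clear; lra.
  by rewrite expr2; move: tL; clear; lra.
have sd2 : 2 <= sd by move: sdL L200; clear; lra.
have p1x : 0 < 1 / x < 1.
  by rewrite divr_gt0//=; move: x1; clear; lra.
have tail := binomial_lower_tail_expR p1x sdV sd2 (ltW t0) cond.
rewrite (_ : m%:R * (1 / x) = lam) in tail; last by rewrite div1r lamN.
pose theta : R := 3 / 4 * expR (- (L / 2 + 100)).
have th0 : 0 < theta by rewrite mulr_gt0 ?expR_gt0// divr_gt0.
have thle : theta <= binomial_mean m (1 / x) (fun k => (k%:R <= lam - t)%R%:R).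
  apply: le_trans tail; rewrite ler_pM2l ?divr_gt0// ler_expR lerN2 lerD2r.
  by rewrite ler_pdivrMr ?exprn_gt0//; move: tsd; clear; lra.
have l_n : (0 < l < n)%N by rewrite l0.
have approx := @expected_shapley_approx R n' m l l_n m0 t theta t0 th0.
rewrite -/n -xN -llN -lamN in approx; have {tail thle} approx := approx thle.
have plx : 0 < ll / x < 1.
  by rewrite divr_gt0//=; move: lx; clear; lra.
have {}median := median m (ll / x) plx (le_trans V0lam (half _ l1 lx)).
rewrite (_ : m%:R * (ll / x) = ll * lam) in median; last by rewrite lamN; ring.
(* The lower bound on [m] leaves [(l + 2) ^+ 2 <= e * kappa * L * x], where [l + 2 <= 3 * L] and
   [x >= L ^+ 2 / 2]. *)
have err1 : m%:R / (lam / (ll + 2)) ^+ 2 <= e.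
  have ll2 : 0 < ll + 2 by rewrite addr_gt0.
  rewrite lamE [leLHS](_ : _ = x * (ll + 2) ^+ 2 / lam); last first.
    by field; rewrite !gt_eqF.
  rewrite ler_pdivrMr//; apply: (@le_trans _ _ (e * (kappa * (x ^+ 2 * L)))); last first.
    by rewrite ler_pM2l.
  rewrite [leRHS](_ : _ = x * ((L * (kappa * e)) * x)); last by ring.
  rewrite ler_pM2l//; apply: (@le_trans _ _ (18 * (L ^+ 2 / 2))); last first.
    by apply: ler_pM => //; rewrite divr_ge0 ?sqr_ge0.
  rewrite (_ : 18 * _ = (3 * L) ^+ 2); last by field.
  rewrite ler_pXn2r ?nnegrE ?(ltW ll2) ?mulr_ge0 ?(ltW L0)//.
  by move: llL L200; clear; lra.
have err2 : ll / x <= e.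
  rewrite ler_pdivrMr//; apply: (@le_trans _ _ (e * (L ^+ 2 / 2))); last first.
    by rewrite ler_pM2l.
  have : 3 * L <= (L * e) * L by rewrite ler_pM2r.
  by rewrite expr2; move: llL L0; clear; lra.
have err3 : 1 / (x * theta) <= e.
  rewrite (ler_pdivrMr _ _ (mulr_gt0 x0 th0)) /theta xE.
  rewrite [leRHS](_ : _ = e * (3 / 4) * (expR L * expR (- (L / 2 + 100)))); last by ring.
  rewrite -expRD (_ : L + _ = L / 2 - 100); last by field.
  apply: (@le_trans _ _ (e * (3 / 4) * (1 + (L / 2 - 100)))); last first.
    by rewrite ler_pM2l ?expR_ge1Dx// mulr_gt0 ?divr_gt0.
  have : e * (198 + 3 / e) <= e * L by rewrite ler_pM2l.
  rewrite mulrDr [e * (3 / e)]mulrC divfK ?gt_eqF//; clear; lra.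
have err4 : ll * lam / t ^+ 2 <= e.
  by rewrite tE le_eqVlt; apply/orP; left; apply/eqP; field; rewrite !gt_eqF.
rewrite epsE; move: approx median err1 err2 err3 err4.
set Q := binomial_mean _ _ _; set P := x * _.
set d1 := _ / _ ^+ 2; set d2 := ll / x; set d3 := 1 / _; set d4 := ll * lam / _.
move=> approx median err1 err2 err3 err4.
apply: (@le_trans _ _ (`|P - Q| + `|Q - 1 / 2|)).
  by rewrite (_ : P - 1 / 2 = (P - Q) + (Q - 1 / 2)) ?ler_normD//; ring.
apply: lerD => //; apply: (le_trans approx).
by rewrite !lerD.
Qed.

Lemma big_omega_lower (R : realType) (f g : nat -> R) :
  ((fun n => f n : R^o) \is 'Omega_\oo (fun n => g n : R^o)) ->
  exists2 kappa : R, 0 < kappa & \forall n \near \oo, kappa * `|g n| <= `|f n|.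
Proof. by rewrite qualifE => /asboolP. Qed.

Theorem theorem4p2 (R : realType) (l m : nat -> nat)
  (l_ge1 : forall n : nat, (0 < n)%N -> (1 <= l n)%N)
  (l_littleo : (fun n : nat => (l n)%:R : R^o) =o_\oo (fun n : nat => ln n%:R : R^o))
  (m_gt0 : forall n : nat, (0 < n)%N -> (0 < m n)%N)
  (m_Omega : (fun n : nat => (m n)%:R : R^o)
               \is 'Omega_\oo (fun n : nat => n%:R ^+ 3 * ln n%:R : R^o)) :
  (* the number of bins is [n = n'.+1] *)
  (fun n' : nat => let n := n'.+1 in
     expected_shapley_min n' (m n) ((l n)%:R * ((m n)%:R / n%:R)) : R^o)
  = (fun n' : nat => 1 / (2 * n'.+1%:R) : R^o)
      +o_\oo (fun n' : nat => 1 / n'.+1%:R : R^o).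
Proof.
have [kappa kap0 mn] := big_omega_lower m_Omega.
apply/eqaddoP => eps eps0.
have [L0 [eta [eta0 main]]] := expected_shapley_min_limit eps0 kap0.
have /eqoP/(_ _ eta0) l_small := l_littleo.
have ln_large : \forall n \near \oo, Num.max L0 0 <= ln n%:R :> R.
  have [N /andP[LN _]] := nat_between (expR_ge0 (Num.max L0 0)).
  exists N => // k Nk; rewrite -[leLHS]expRK ler_ln ?posrE ?expR_gt0//.
    by rewrite (le_trans LN)// ler_nat.
  by rewrite (lt_le_trans (expR_gt0 _) (le_trans LN _))// ler_nat.
(* The hypotheses are indexed by [n], the conclusion by [n' = n - 1]. *)
have shift (P : nat -> Prop) : (\forall n \near \oo, P n) -> \forall n \near \oo, P n.+1.
  by move=> [N _ PN]; exists N => // k Nk; apply: PN; exact: leqW.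
near=> n'.
have : Num.max L0 0 <= ln n'.+1%:R by near: n'; exact: (shift _ ln_large).
rewrite ge_max => /andP[L1 ln0].
have l1 : (l n'.+1)%:R <= eta * ln n'.+1%:R.
  have h : `|(l n'.+1)%:R : R^o| <= eta * `|ln n'.+1%:R : R^o|.
    by near: n'; exact: (shift _ l_small).
  by move: h; rewrite normr_nat (ger0_norm ln0).
have m1 : kappa * (n'.+1%:R ^+ 3 * ln n'.+1%:R) <= (m n'.+1)%:R.
  have h : kappa * `|n'.+1%:R ^+ 3 * ln n'.+1%:R : R| <= `|(m n'.+1)%:R : R|.
    by near: n'; exact: (shift _ mn).
  by move: h; rewrite normr_nat ger0_norm// mulr_ge0// exprn_ge0.
have := main n' (m n'.+1) (l n'.+1) L1 (l_ge1 n'.+1 isT) l1 m1.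
set phi := expected_shapley_min _ _ _ => bound.
have n0 : 0 < n'.+1%:R :> R by rewrite ltr0n.
rewrite [X in `|X|](_ : _ = (n'.+1%:R * phi - 1 / 2) / n'.+1%:R); last first.
  rewrite [LHS](_ : _ = phi - 1 / (2 * n'.+1%:R))//.
  by field; rewrite nat1r gt_eqF.
apply: (@le_trans _ _ (eps * `|n'.+1%:R^-1|)); last by rewrite /= div1r.
by rewrite normrM ler_pM2r// normr_gt0 invr_eq0 gt_eqF.
Unshelve. all: by end_near. Qed.
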